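(* Let $n\ge 1$ and let $g$ be a pseudo-Riemannian metric on a coordinate domain with coordinates $(x_1,\dots,x_n)$. Suppose $(x_1,\dots,x_n)$ are orthogonal separable coordinates for $g$ with diagonal curvature. Then, after possibly renumbering the coordinates, $g$ has one of the following two forms. (1) There is a partition $\{1,\dots,n\}=M\cup\bigcup_{I\in P}I$ (with $P$ a finite, possibly empty, index set of nonempty subsets, and either $M\neq\emptyset$ or $|P|\ge 2$), functions $\Phi_a=\Phi_a(x_a)$ and non-constant functions $\sigma_a=\sigma_a(x_a)$ for $a\in M$, constants $e_I$ for $I\in P$, and tensors $g^I=\sum_{i,j\in I} f^I_{ij}(x^I)\,dx_i\,dx_j$ for $I\in P$ depending only on the coordinates $x^I=(x_i)_{i\in I}$, such that $$g=\sum_{a\in M}\Phi_a\prod_{b\in M,\,b\ne a}(\sigma_a-\sigma_b)\,dx_a^2+\sum_{I\in P}\Big(\prod_{a\in M}(e_I-\sigma_a)\Big)g^I .$$ (2) There is a partition $\{2,\dots,n\}=I_1\cup\dots\cup I_p$ into nonempty subsets, a function $\Phi_1=\Phi_1(x_1)$, non-constant functions $\sigma_1^{I}=\sigma_1^{I}(x_1)$, and tensors $g^I=\sum_{i,j\in I} f^I_{ij}(x^I)\,dx_i\,dx_j$ depending only on $x^I=(x_i)_{i\in I}$, for $I\in\{I_1,\dots,I_p\}$, such that $$g=\Phi_1\,dx_1^2+\sum_{I\in\{I_1,\dots,I_p\}}\sigma_1^{I}\,g^I .$$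
   Context: Everything is smooth and local; coordinate domains are taken to be products of open intervals. Empty products equal $1$. Coordinates $(x_1,\dots,x_n)$ are orthogonal for $g$ if $g$ is diagonal in them: $g=\sum_i e_iH_i^2dx_i^2$ with $e_i=\pm1$, $H_i>0$. Coordinates are separable if the geodesic Hamilton-Jacobi equation $\tfrac12 g^{ij}\,\partial_iW\,\partial_jW=E$ admits a complete integral of the form $W=\sum_i W_i(x_i;c_1,\dots,c_n)$ with $\det(\partial^2W/\partial x_i\partial c_j)\neq0$. For orthogonal coordinates this is equivalent to the Levi-Civita equations: for all distinct $i,j,k$, $$\partial_i\partial_j\log H_i^2+\partial_j\log H_i^2\,\partial_i\log H_j^2=0,$$ $$\partial_j\partial_k\log H_i^2-\partial_j\log H_i^2\,\partial_k\log H_i^2+\partial_j\log H_i^2\,\partial_k\log H_j^2+\partial_k\log H_i^2\,\partial_j\log H_k^2=0.$$ Coordinates have diagonal curvature if the Riemann curvature tensor of $g$ satisfies $R_{ijik}=0$ for all $j\ne k$ in the coordinate basis. *)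

(* Defs.v *)
From HB Require Import structures.
From mathcomp Require Import all_boot all_order all_algebra.
From mathcomp Require Import all_classical all_reals all_analysis.
Set Implicit Arguments.
Unset Strict Implicit.
Unset Printing Implicit Defensive.
Import Order.TTheory GRing.Theory Num.Theory.
Import numFieldNormedType.Exports.
Local Open Scope classical_set_scope.
Local Open Scope ring_scope.

Fixpoint iter_derive (R : realType) (V : normedModType R) (s : seq V)
    (f : V -> R) : V -> R :=
  if s is v :: s' then (fun x => 'D_v (iter_derive s' f) x) else f.

(* C^oo on the open set A: every iterated directional derivative is
   differentiable at every point of A.  Used with V = R, R^n and R * R^n. *)
Definition smooth_on (R : realType) (V : normedModType R) (A : set V)
    (f : V -> R) : Prop :=
  forall (s : seq V) (x : V), A x -> differentiable (iter_derive s f) x.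

Definition open_intervals (R : realType) (n : nat) (J : 'I_n -> set R) : Prop :=
  forall i, [/\ open (J i), is_interval (J i) & J i !=set0].

Definition box (R : realType) (n : nat) (J : 'I_n -> set R) : set 'rV[R]_n :=
  [set x | forall i, J i (x 0 i)].

Definition nonconstant_on (R : realType) (A : set R) (f : R -> R) : Prop :=
  exists s t, [/\ A s, A t & f s != f t].

Definition partial (R : realType) (n : nat) (i : 'I_n) (f : 'rV[R]_n -> R)
    (x : 'rV[R]_n) : R :=
  'D_(delta_mx 0 i) f x.

Definition pseudo_riemannian (R : realType) (n : nat) (D : set 'rV[R]_n)
    (g : 'rV[R]_n -> 'M[R]_n) : Prop :=
  [/\ forall i j, smooth_on D (fun x => g x i j),
      forall x, D x -> (g x)^T = g x
    & forall x, D x -> g x \in unitmx].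

Definition orthogonal_coordinates (R : realType) (n : nat) (D : set 'rV[R]_n)
    (g : 'rV[R]_n -> 'M[R]_n) : Prop :=
  exists (e : 'I_n -> R) (H : 'I_n -> 'rV[R]_n -> R),
    [/\ forall i, e i = 1 \/ e i = -1,
        forall i, smooth_on D (H i),
        forall i x, D x -> 0 < H i x
      & forall x, D x -> g x = diag_mx (\row_i (e i * H i x ^+ 2))].

(* W x c is a solution of the geodesic Hamilton-Jacobi equation for every value
   c of the n parameters; the energy is a function of c, since n independent
   parameters cannot all lie on one energy level. *)
Definition complete_integral (R : realType) (n : nat)
    (g : 'rV[R]_n -> 'M[R]_n) (U C : set 'rV[R]_n)
    (W : 'rV[R]_n -> 'rV[R]_n -> R) (E : 'rV[R]_n -> R) : Prop :=
  forall x c, U x -> C c ->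
    2^-1 * (\sum_i \sum_j invmx (g x) i j
              * partial i (fun y => W y c) x * partial j (fun y => W y c) x)
      = E c
    /\ \det (\matrix_(i, j)
               partial j (fun b => partial i (fun y => W y b) x) c) != 0.

(* A separated complete integral is required near each point only: even for
   separable coordinates it may fail to exist on the whole domain (polar
   coordinates in the plane, where it breaks down at turning points). *)
Definition separable_coordinates (R : realType) (n : nat) (D : set 'rV[R]_n)
    (g : 'rV[R]_n -> 'M[R]_n) : Prop :=
  forall x0, D x0 ->
    exists (K : 'I_n -> set R) (C : set 'rV[R]_n)
           (W : 'I_n -> R -> 'rV[R]_n -> R) (E : 'rV[R]_n -> R),
      [/\ open_intervals K, box K x0 & box K `<=` D] /\
      [/\ open C, C !=set0,
          forall i, smooth_on (K i `*` C) (fun z : R * 'rV[R]_n => W i z.1 z.2)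
        & complete_integral g (box K) C
            (fun x c => \sum_i W i (x 0 i) c) E].

Definition christoffel (R : realType) (n : nat) (g : 'rV[R]_n -> 'M[R]_n)
    (k i j : 'I_n) (x : 'rV[R]_n) : R :=
  2^-1 * \sum_l invmx (g x) k l *
    (partial i (fun y => g y j l) x + partial j (fun y => g y i l) x
     - partial l (fun y => g y i j) x).

(* riemann g i j k l x = R_{ijkl}(x) = g(R(d_k, d_l) d_j, d_i), where
   R(X, Y) Z = D_X D_Y Z - D_Y D_X Z - D_[X,Y] Z. *)
Definition riemann (R : realType) (n : nat) (g : 'rV[R]_n -> 'M[R]_n)
    (i j k l : 'I_n) (x : 'rV[R]_n) : R :=
  \sum_m g x i m *
    (partial k (christoffel g m l j) x - partial l (christoffel g m k j) x
     + \sum_p (christoffel g m k p x * christoffel g p l j x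
               - christoffel g m l p x * christoffel g p k j x)).

Definition diagonal_curvature (R : realType) (n : nat) (D : set 'rV[R]_n)
    (g : 'rV[R]_n -> 'M[R]_n) : Prop :=
  forall x, D x -> forall i j k : 'I_n, j != k -> riemann g i j i k x = 0.

Definition depends_only_on (R : realType) (n : nat) (I : {set 'I_n})
    (D : set 'rV[R]_n) (f : 'rV[R]_n -> R) : Prop :=
  forall x y, D x -> D y -> (forall i, i \in I -> x 0 i = y 0 i) -> f x = f y.

(* The coefficient matrix at x of sum_(i, j in I) f i j dx_i dx_j. *)
Definition block_tensor (R : realType) (n : nat) (I : {set 'I_n})
    (f : 'I_n -> 'I_n -> 'rV[R]_n -> R) (x : 'rV[R]_n) : 'M[R]_n :=
  \sum_(i in I) \sum_(j in I) f i j x *: delta_mx i j.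

Definition block_coefficients (R : realType) (n : nat) (D : set 'rV[R]_n)
    (I : {set 'I_n}) (f : 'I_n -> 'I_n -> 'rV[R]_n -> R) : Prop :=
  forall i j, i \in I -> j \in I ->
    smooth_on D (f i j) /\ depends_only_on I D (f i j).

Definition form1 (R : realType) (n : nat) (J : 'I_n -> set R)
    (g : 'rV[R]_n -> 'M[R]_n) : Prop :=
  exists (M : {set 'I_n}) (P : {set {set 'I_n}})
         (Phi sigma : 'I_n -> R -> R) (e : {set 'I_n} -> R)
         (f : {set 'I_n} -> 'I_n -> 'I_n -> 'rV[R]_n -> R),
    [/\ finset.partition P (~: M)%SET,
        M != finset.set0 \/ (1 < #|P|)%N,
        forall a, a \in M -> [/\ smooth_on (J a) (Phi a),
          smooth_on (J a) (sigma a) & nonconstant_on (J a) (sigma a)],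
        forall I, I \in P -> block_coefficients (box J) I (f I)
      & forall x, box J x ->
          g x =
            \sum_(a in M)
              (Phi a (x 0 a) *
                 \prod_(b in M | b != a) (sigma a (x 0 a) - sigma b (x 0 b)))
              *: delta_mx a a
            + \sum_(I in P)
              (\prod_(a in M) (e I - sigma a (x 0 a)))
              *: block_tensor I (f I) x].

(* The index o is the coordinate called x_1 after renumbering. *)
Definition form2 (R : realType) (n : nat) (J : 'I_n -> set R)
    (g : 'rV[R]_n -> 'M[R]_n) : Prop :=
  exists (o : 'I_n) (P : {set {set 'I_n}}) (Phi : R -> R)
         (sigma : {set 'I_n} -> R -> R)
         (f : {set 'I_n} -> 'I_n -> 'I_n -> 'rV[R]_n -> R),
    [/\ finset.partition P [set~ o]%SET,
        smooth_on (J o) Phi,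
        forall I, I \in P ->
          smooth_on (J o) (sigma I) /\ nonconstant_on (J o) (sigma I),
        forall I, I \in P -> block_coefficients (box J) I (f I)
      & forall x, box J x ->
          g x = Phi (x 0 o) *: delta_mx o o
                + \sum_(I in P) sigma I (x 0 o) *: block_tensor I (f I) x].

(* Main.v *)
Require Import Defs.
From HB Require Import structures.
From mathcomp Require Import all_boot all_order all_algebra.
From mathcomp Require Import all_classical all_reals all_analysis.
From mathcomp Require Import ring lra.
Import Order.TTheory GRing.Theory Num.Theory.
Import numFieldNormedType.Exports.
Local Open Scope classical_set_scope.
Local Open Scope ring_scope.
Set Implicit Arguments.
Unset Strict Implicit.
Unset Printing Implicit Defensive.

(** Write G_i = g_ii and a_ij = d_j log |G_i|.  Separability gives the
    Levi-Civita equations; together with the vanishing of R_ijik they amount, for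
    distinct i, j, k, to
      d_i a_ij = - a_ij a_ji,  d_k a_ij = 0,  a_ij a_ik = a_ij a_jk + a_ik a_kj.
    Say that j affects i if a_ij is not identically zero.  The quadratic relation
    makes this transitive, and any two coordinates affecting a third one
    comparable, so the coordinates form a forest of equivalence classes.  Let r
    be maximal.  If r does not affect everything, g is a product.  If r affects
    everything and nothing affects r, g is a warped product over x_r, which is
    form (2).  Otherwise some q and r affect each other; integrating the
    equations in the (x_r, x_q)-plane and then using the quadratic relation
    produces functions S_c(x_c), one for each coordinate, such that
    a_cb (S_b - S_c) = d_b S_b for all b <> c.  The non-constant ones are the
    sigma_a of form (1), and the level sets of the constant ones are its blocks. *)

(** * Smooth functions and their composition with affine maps *)

Lemma derive_comp_line (R : realType) (V W : normedModType R) (f : W -> R)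
    (L : V -> W) (x v : V) (w : W) :
  (forall h : R, L (h *: v + x) = h *: w + L x) ->
  'D_v (f \o L) x = 'D_w f (L x).
Proof.
move=> hL; rewrite /derive.
by under eq_fun => h do rewrite /= hL.
Qed.

Section SmoothOn.
Context (R : realType) (V : normedModType R).
Implicit Types (A B : set V) (f g : V -> R).

Lemma iter_derive_rcons s v f :
  iter_derive (rcons s v) f = iter_derive s ('D_v f : V -> R).
Proof. by elim: s => //= u s ->. Qed.

Lemma smooth_differentiable A f x :
  smooth_on A f -> A x -> differentiable f x.
Proof. by move=> sf Ax; exact: (sf [::] x Ax). Qed.

Lemma smooth_derivable A f x v : smooth_on A f -> A x -> derivable f x v.
Proof. by move=> sf Ax; exact/diff_derivable/(smooth_differentiable sf). Qed.

Lemma smooth_derive A f v : smooth_on A f -> smooth_on A ('D_v f : V -> R).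
Proof. by move=> sf s x Ax; rewrite -iter_derive_rcons; exact: sf. Qed.

Lemma smooth_sub A B f : A `<=` B -> smooth_on B f -> smooth_on A f.
Proof. by move=> AB sf s x /AB Bx; exact: sf. Qed.

Lemma smooth_cst A (c : R) : smooth_on A (fun _ => c).
Proof.
move=> s; suff [k ->] : exists k, iter_derive s (fun _ : V => c) = cst k.
  by move=> x _; exact: differentiable_cst.
elim: s => [|v s [k IH]] /=; first by exists c.
by exists 0; rewrite IH; apply/funext => x; exact: derive_cst.
Qed.

(* The algebra generated by the smooth functions is stable under directional
   derivatives, so all of its members are smooth. *)
Inductive smooth_alg A : (V -> R) -> Prop :=
| SAsmooth f : smooth_on A f -> smooth_alg A f
| SAext f g : (forall y, A y -> f y = g y) -> smooth_alg A g -> smooth_alg A f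
| SAadd f g : smooth_alg A f -> smooth_alg A g ->
    smooth_alg A (fun x => f x + g x)
| SAmul f g : smooth_alg A f -> smooth_alg A g ->
    smooth_alg A (fun x => f x * g x)
| SAinv f : (forall x, A x -> f x != 0) -> smooth_alg A f ->
    smooth_alg A (fun x => (f x)^-1).

Lemma eq_near A f g x : open A -> A x -> (forall y, A y -> f y = g y) ->
  \near x, f x = g x.
Proof.
move=> oA Ax fg; near=> y; apply: fg; near: y.
exact: open_nbhs_nbhs.
Unshelve. all: by end_near. Qed.

Lemma eq_derive A f g x v : open A -> A x -> (forall y, A y -> f y = g y) ->
  'D_v f x = 'D_v g x.
Proof. by move=> oA Ax fg; apply: near_eq_derive; exact: eq_near fg. Qed.


(** The zero map serves as the differential. This lets differentiability pass between functions that
    agree only near a point. *)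
Lemma near0_differentiable f x : (\near x, f x = 0) -> differentiable f x.
Proof.
move=> f0; have fx0 : f x = 0 by exact: nbhs_singleton f0.
apply/diffP => /=.
apply: (@getPex _ (fun (df : {linear V -> R}) => continuous df /\
  forall y, f y = f (lim (nbhs x)) + df (y - lim (nbhs x))
                  +o_(y \near x) (y - lim (nbhs x)))).
exists (\0 : {linear V -> R}); split; first by move=> y; exact: cst_continuous.
suff h0 : f = cst 0 +o_ x (fun y => y - lim (nbhs x)).
  by move=> y; rewrite {1}h0 lim_id // fx0 /= addr0.
apply/eqaddoP => e e0; near=> y; rewrite /= (_ : (f - cst 0) y = 0).
  by rewrite normr0 mulr_ge0 // ltW.
by rewrite fctE /= subr0; near: y.
Unshelve. all: by end_near. Qed.

Lemma eq_differentiable A f g x : open A -> A x ->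
  (forall y, A y -> f y = g y) -> differentiable g x -> differentiable f x.
Proof.
move=> oA Ax fg dg; rewrite (_ : f = g + (f - g)); last by rewrite addrC subrK.
apply: differentiableD => //; apply: near0_differentiable.
near=> y; apply/eqP; rewrite subr_eq0; apply/eqP; near: y.
exact: eq_near fg.
Unshelve. all: by end_near. Qed.

Lemma smooth_algP A f : open A -> smooth_alg A f ->
  (forall x, A x -> differentiable f x)
  /\ forall v, smooth_alg A ('D_v f : V -> R).
Proof.
move=> oA; elim.
- move=> {}f sf; split=> [x Ax|v]; first exact: smooth_differentiable Ax.
  by apply: SAsmooth; exact: smooth_derive.
- move=> {}f g fg _ [dg Dg]; split=> [x Ax|v].
    by apply: (eq_differentiable oA Ax fg); exact: dg.
  apply: SAext (Dg v) => x Ax; exact: eq_derive fg.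
- move=> {}f g sf [df Df] sg [dg Dg]; split=> [x Ax|v].
    by apply: differentiableD; [exact: df|exact: dg].
  apply: SAext (SAadd (Df v) (Dg v)) => x Ax.
  by rewrite deriveD //; apply: diff_derivable; [exact: df|exact: dg].
- move=> {}f g sf [df Df] sg [dg Dg]; split=> [x Ax|v].
    by apply: differentiableM; [exact: df|exact: dg].
  apply: SAext (SAadd (SAmul sf (Dg v)) (SAmul sg (Df v))) => x Ax.
  by rewrite deriveM //; apply: diff_derivable; [exact: df|exact: dg].
- move=> {}f f0 sf [df Df]; split=> [x Ax|v].
    by apply: differentiableV; [exact: df|exact: f0].
  pose m1 : V -> R := fun _ => -1.
  apply: (@SAext _ _ (fun x => (m1 x * ((f x)^-1 * (f x)^-1)) * 'D_v f x)).
    move=> x Ax; rewrite deriveV; [|exact: f0|exact/diff_derivable/df].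
    by rewrite /m1 mulN1r -invfM -expr2.
  apply: SAmul (Df v); apply: SAmul; first exact/SAsmooth/smooth_cst.
  by apply: SAmul; exact: SAinv.
Qed.

Lemma smooth_alg_smooth A f : open A -> smooth_alg A f -> smooth_on A f.
Proof.
move=> oA sf s; suff /(smooth_algP oA)[] : smooth_alg A (iter_derive s f) by [].
by elim: s => //= v s /(smooth_algP oA)[_]; exact.
Qed.

Lemma smooth_ext A f g : open A -> (forall x, A x -> f x = g x) ->
  smooth_on A g -> smooth_on A f.
Proof.
by move=> oA fg sg; apply: smooth_alg_smooth => //; exact: SAext (SAsmooth sg).
Qed.

Lemma smoothD A f g : open A -> smooth_on A f -> smooth_on A g ->
  smooth_on A (fun x => f x + g x).
Proof.
move=> oA sf sg; apply: smooth_alg_smooth => //.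
exact: SAadd (SAsmooth sf) (SAsmooth sg).
Qed.

Lemma smoothM A f g : open A -> smooth_on A f -> smooth_on A g ->
  smooth_on A (fun x => f x * g x).
Proof.
move=> oA sf sg; apply: smooth_alg_smooth => //.
exact: SAmul (SAsmooth sf) (SAsmooth sg).
Qed.

Lemma smoothV A f : open A -> (forall x, A x -> f x != 0) ->
  smooth_on A f -> smooth_on A (fun x => (f x)^-1).
Proof.
move=> oA f0 sf; apply: smooth_alg_smooth => //.
exact: SAinv (SAsmooth sf).
Qed.

Lemma smoothB A f g : open A -> smooth_on A f -> smooth_on A g ->
  smooth_on A (fun x => f x - g x).
Proof.
move=> oA sf sg; apply: (@smooth_ext _ _ (fun x => f x + -1 * g x)) => //.
  by move=> x _; rewrite mulN1r.
by apply: smoothD => //; apply: smoothM => //; exact: smooth_cst.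
Qed.

Lemma smooth_div A f g : open A -> (forall x, A x -> g x != 0) ->
  smooth_on A f -> smooth_on A g -> smooth_on A (fun x => f x / g x).
Proof. by move=> oA g0 sf sg; apply: smoothM => //; exact: smoothV. Qed.

Lemma smooth_prod A (I : finType) (P : pred I) (F : I -> V -> R) : open A ->
  (forall i, P i -> smooth_on A (F i)) ->
  smooth_on A (fun x => \prod_(i | P i) F i x).
Proof.
move=> oA sF.
rewrite (_ : (fun _ => _) = \big[(fun f g x => f x * g x)/(fun=> 1)]_(i | P i) F i).
  apply: (big_ind (smooth_on A)) => //; first exact: smooth_cst.
  by move=> f g; exact: smoothM.
apply/funext => x.
by elim/big_rec2: _ => // i y f _ ->.
Qed.

End SmoothOn.

(** [L] is affine with linear part [L0]: it carries a line along [v] to a line along [L0 v], so the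
    difference quotients agree exactly and no chain rule is involved. *)
Lemma iter_derive_comp (R : realType) (V W : normedModType R) (f : W -> R)
    (L : V -> W) (L0 : V -> W) (s : seq V) :
  (forall (x v : V) (h : R), L (h *: v + x) = h *: L0 v + L x) ->
  iter_derive s (f \o L) = iter_derive (map L0 s) f \o L.
Proof.
move=> hL; elim: s => //= v s ->.
by apply/funext => x; apply: derive_comp_line => h; exact: hL.
Qed.

Lemma smooth_comp (R : realType) (V W : normedModType R) (A : set V)
    (B : set W) (f : W -> R) (L L0 : V -> W) :
  (forall x v (h : R), L (h *: v + x) = h *: L0 v + L x) ->
  (forall x, A x -> B (L x)) -> (forall x, A x -> differentiable L x) ->
  smooth_on B f -> smooth_on A (fun x => f (L x)).
Proof.
move=> hL AB dL sf s x Ax; rewrite (iter_derive_comp f s hL).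
by apply: differentiable_comp; [exact: dL|exact/sf/AB].
Qed.

Lemma derivable_comp_line (R : realType) (V W : normedModType R) (f : W -> R)
    (L : V -> W) (x v : V) (w : W) :
  (forall h : R, L (h *: v + x) = h *: w + L x) ->
  derivable f (L x) w -> derivable (f \o L) x v.
Proof.
move=> hL; rewrite /derivable.
suff -> : (fun h : R => h^-1 *: ((f \o L \o shift x) (h *: v) - (f \o L) x)) =
    (fun h => h^-1 *: ((f \o shift (L x)) (h *: w) - f (L x))) by [].
by apply/funext => h /=; rewrite hL.
Qed.

(** * Calculus on a product of intervals *)

Definition mix (R : realType) (n : nat) (I : {set 'I_n}) (x y : 'rV[R]_n) :
  'rV[R]_n := \row_i (if i \in I then x 0 i else y 0 i).

Section Box.
Context (R : realType) (n : nat) (J : 'I_n -> set R).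
Hypothesis hJ : open_intervals J.
Implicit Types (f g : 'rV[R]_n -> R) (x y p : 'rV[R]_n) (I : {set 'I_n}).
Local Notation B := (box J).

Lemma mixE I x y i : mix I x y 0 i = if i \in I then x 0 i else y 0 i.
Proof. by rewrite mxE. Qed.

Lemma box_mix I x y : B x -> B y -> B (mix I x y).
Proof. by move=> Bx By i; rewrite mixE; case: ifP. Qed.

Lemma box_open : open B.
Proof.
rewrite openE => x Bx.
apply: (@filter_forall 'rV[R]_n 'I_n (fun i y => J i (y 0 i)) (nbhs x)) => i.
have [oJ _ _] := hJ i.
have /(_ (J i)) := @coord_continuous R 1 n 0 i x; apply.
by apply: open_nbhs_nbhs; split => //; exact: Bx.
Qed.

Lemma box_point : exists p, B p.
Proof.
have /choice[t tP] : forall i, exists t, J i t by move=> i; have [_ _] := hJ i.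
by exists (\row_i t i) => i; rewrite mxE.
Qed.

Lemma partial_ext k f g x : B x -> (forall y, B y -> f y = g y) ->
  partial k f x = partial k g x.
Proof. by move=> Bx fg; exact: (eq_derive _ box_open Bx). Qed.

Lemma partial_cst k (c : R) x : partial k (fun _ => c) x = 0.
Proof. exact: derive_cst. Qed.

Lemma partialD k f g x : smooth_on B f -> smooth_on B g -> B x ->
  partial k (fun y => f y + g y) x = partial k f x + partial k g x.
Proof. by move=> sf sg Bx; rewrite /partial deriveD //; apply: smooth_derivable Bx. Qed.

Lemma partialB k f g x : smooth_on B f -> smooth_on B g -> B x ->
  partial k (fun y => f y - g y) x = partial k f x - partial k g x.
Proof. by move=> sf sg Bx; rewrite /partial deriveB //; apply: smooth_derivable Bx. Qed.

Lemma partialM k f g x : smooth_on B f -> smooth_on B g -> B x ->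
  partial k (fun y => f y * g y) x = partial k f x * g x + f x * partial k g x.
Proof.
move=> sf sg Bx; rewrite /partial deriveM; try exact: smooth_derivable Bx.
by rewrite addrC; congr (_ + _); rewrite /GRing.scale /= mulrC.
Qed.

Lemma partialV k f x : smooth_on B f -> B x -> f x != 0 ->
  partial k (fun y => (f y)^-1) x = - partial k f x / (f x) ^+ 2.
Proof.
move=> sf Bx f0; rewrite /partial deriveV //; last exact: smooth_derivable Bx.
by rewrite /GRing.scale /= mulNr mulNr mulrC.
Qed.

Lemma smooth_partial k f : smooth_on B f -> smooth_on B (partial k f).
Proof. exact: smooth_derive. Qed.

Lemma partial_div k f g x : smooth_on B f -> smooth_on B g ->
  (forall y, B y -> g y != 0) -> B x ->
  partial k (fun y => f y / g y) x =
  (partial k f x * g x - f x * partial k g x) / (g x) ^+ 2.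
Proof.
move=> sf sg g0 Bx; rewrite partialM //; last exact: smoothV box_open _ _.
by rewrite partialV //; [field; exact: g0|exact: g0].
Qed.

Definition coord_mask I x : 'rV[R]_n := \row_i (if i \in I then x 0 i else 0).

Lemma mix_affine I p x v (h : R) :
  mix I (h *: v + x) p = h *: coord_mask I v + mix I x p.
Proof.
by apply/rowP => i; rewrite !mxE; case: ifP => _ //; rewrite mulr0 add0r.
Qed.

Lemma differentiable_mix I p x : differentiable (mix I ^~ p) x.
Proof.
rewrite (_ : mix I ^~ p = cst (mix I 0 p) +
    \sum_i (fun y : 'rV[R]_n => y 0 i *: (if i \in I then delta_mx 0 i else 0 : 'rV[R]_n))).
  apply: differentiableD => //; apply: differentiable_sum => i.
  by apply: differentiableZl; exact: differentiable_coord.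
apply/funext => y; rewrite fctE /= fct_sumE; apply/rowP => i.
rewrite !mxE summxE (bigD1 i) //= big1 => [|j ji]; rewrite !mxE.
  by case: ifP => _; rewrite !mxE ?eqxx ?mulr0 ?addr0 ?add0r ?mulr1.
by case: ifP => _; rewrite !mxE ?mulr0 // eq_sym (negbTE ji) mulr0.
Qed.

Lemma smooth_mix I p f : B p -> smooth_on B f ->
  smooth_on B (fun x => f (mix I x p)).
Proof.
move=> Bp; apply: (smooth_comp (L0 := coord_mask I)) => [x v h|x Bx|x _].
- exact: mix_affine.
- exact: box_mix.
- exact: differentiable_mix.
Qed.

(** The mask keeps the direction of x_k when [k] is in [I] and kills it otherwise. *)
Lemma partial_mix I p f k x :
  partial k (fun y => f (mix I y p)) x =
  if k \in I then partial k f (mix I x p) else 0.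
Proof.
have hm h : mix I (h *: delta_mx 0 k + x) p =
    h *: coord_mask I (delta_mx 0 k) + mix I x p by exact: mix_affine.
rewrite /partial (derive_comp_line f hm); case: ifP => kI.
  congr (derive _ _ _); apply/rowP => i; rewrite !mxE /=.
  by case: ifP => //; case: eqVneq => // ->; rewrite kI.
rewrite (_ : coord_mask _ _ = 0) ?derive0 //; apply/rowP => i; rewrite !mxE /=.
by case: ifP => //; case: eqVneq => // ->; rewrite kI.
Qed.

Lemma dep_partial0 I f k x : depends_only_on I B f -> k \notin I -> B x ->
  partial k f x = 0.
Proof.
move=> df kI Bx; rewrite (@partial_ext _ _ (fun y => f (mix I y x))) //.
  by rewrite partial_mix (negbTE kI).
by move=> y By; apply: df => //; [exact: box_mix|move=> i iI; rewrite mixE iI].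
Qed.

Lemma dep_partial I f k : depends_only_on I B f ->
  depends_only_on I B (partial k f).
Proof.
move=> df; case: (boolP (k \in I)) => [kI|kI] x y Bx By xy; last first.
  by rewrite !(dep_partial0 df).
rewrite (@partial_ext _ _ (fun z => f (mix I z y))) //.
  rewrite partial_mix kI; congr (partial k f _); apply/rowP => i.
  by rewrite mixE; case: ifP => // /xy.
by move=> z Bz; apply: df => //; [exact: box_mix|move=> i iI; rewrite mixE iI].
Qed.

(** The mean value theorem on the segment from [x] to [y], which stays in the box because [J k] is
    an interval. *)
Lemma partial0_line f k x y : smooth_on B f ->
  (forall z, B z -> partial k f z = 0) -> B x -> B y ->
  (forall i, i != k -> x 0 i = y 0 i) -> f x = f y.
Proof.
move=> sf f0; wlog xy : x y / x 0 k <= y 0 k.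
  move=> H Bx By exy; case: (leP (x 0 k) (y 0 k)) => [/H|/ltW /H yx]; first exact.
  by symmetry; apply: yx => // i /exy.
move=> Bx By exy; pose s := y 0 k - x 0 k.
pose L (t : R) : 'rV[R]_n := t *: delta_mx 0 k + x.
have hL t (h : R) : L (h *: 1 + t) = h *: delta_mx 0 k + L t.
  by rewrite /L scalerDl addrA /GRing.scale /= mulr1.
have BL t : t \in `[0, s] -> B (L t).
  rewrite in_itv /= => /andP[t0 ts] i; rewrite !mxE /=.
  have [->|ik] := eqVneq i k; last by rewrite mulr0 add0r.
  have [_ Jk _] := hJ k; apply: (Jk (x 0 k) (y 0 k)) => //.
  by rewrite mulr1 lerDr t0 /= -lerBrDr.
have dL t : t \in `[0, s] -> is_derive t 1 (f \o L) 0.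
  move=> ts; apply: DeriveDef.
    apply: (derivable_comp_line (hL t)).
    by apply: smooth_derivable sf _; exact: BL.
  by rewrite (derive_comp_line f (hL t)); apply: f0; exact: BL.
have s0 : 0 <= s by rewrite subr_ge0.
have d0 t : t \in `]0, s[ -> is_derive t 1 (f \o L) ((fun=> 0) t).
  by move=> ts; apply: dL; exact: subset_itv_oo_cc ts.
have cL : {within `[0, s], continuous (f \o L)}.
  by apply: derivable_within_continuous => t /dL [].
have [c _] := MVT_segment s0 d0 cL.
rewrite mul0r /= => /eqP; rewrite subr_eq0 => /eqP; rewrite /L scale0r add0r => <-.
congr f; apply/rowP => i; rewrite !mxE /=.
have [->|ik] := eqVneq i k; first by rewrite mulr1 subrK.
by rewrite mulr0 add0r exy.
Qed.

Lemma partial0_dep I f : smooth_on B f ->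
  (forall k z, k \notin I -> B z -> partial k f z = 0) ->
  depends_only_on I B f.
Proof.
move=> sf f0 x y Bx By xy.
(* In [m s] the coordinates listed in [s] have been moved from [x] to [y]; they are changed one at a
   time. *)
pose m (s : seq 'I_n) := mix [set i | i \in s]%SET y x.
suff H s : (forall k, k \in s -> k \notin I) -> f (m s) = f x.
  rewrite -(H (enum (~: I)%SET)); last by move=> k; rewrite mem_enum inE.
  congr f; apply/rowP => i; rewrite mixE inE mem_enum inE.
  by case: ifP => // /negbFE /xy.
elim: s => [_|k s IH sI].
  by congr f; apply/rowP => i; rewrite mixE inE in_nil.
rewrite -IH; last by move=> j js; apply: sI; rewrite in_cons js orbT.
apply: (@partial0_line _ k) => //; try exact: box_mix.
- by move=> z Bz; apply: f0 => //; apply: sI; rewrite mem_head.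
- by move=> i ik; rewrite !mixE !inE (negbTE ik).
Qed.

End Box.

Section BoxSums.
Context (R : realType) (n : nat) (J : 'I_n -> set R).
Hypothesis hJ : open_intervals J.
Local Notation B := (box J).

Lemma partial_sum (I : finType) (F : I -> 'rV[R]_n -> R) k x :
  (forall i, smooth_on B (F i)) -> B x ->
  partial k (fun y => \sum_i F i y) x = \sum_i partial k (F i) x.
Proof.
move=> sF Bx; pose add (f g : 'rV[R]_n -> R) y := f y + g y.
rewrite (_ : (fun _ => _) = \big[add/(fun=> 0)]_i F i); last first.
  by apply/funext => y; elim/big_rec2: _ => // i z f _ ->.
suff [] : smooth_on B (\big[add/(fun=> 0)]_i F i) /\
  partial k (\big[add/(fun=> 0)]_i F i) x = \sum_i partial k (F i) x by [].
elim/big_rec2: _ => [|i y f _ [sf <-]].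
  by split; [exact: smooth_cst|exact: partial_cst].
by split; [apply: smoothD => //; exact: box_open|exact: partialD].
Qed.

End BoxSums.

(** This is d_k log |G_i|, the a_ik of the overview; dividing instead of taking a logarithm makes
    the sign of G_i irrelevant. *)
Definition logd (R : realType) (n : nat) (G : 'I_n -> 'rV[R]_n -> R)
  (i k : 'I_n) (x : 'rV[R]_n) : R := partial k (G i) x / G i x.

(** * Separation of variables *)

Section Staeckel.
Context (R : realType) (n : nat) (K : 'I_n -> set R).
Hypothesis hK : open_intervals K.
Local Notation B := (box K).
Variables (G P : 'I_n -> 'rV[R]_n -> R) (E : R).
Hypothesis sG : forall i, smooth_on B (G i).
Hypothesis G0 : forall i x, B x -> G i x != 0.
Hypothesis sP : forall i, smooth_on B (P i).
Hypothesis dP : forall i, depends_only_on [set i]%SET B (P i).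
Hypothesis sumP : forall x, B x -> \sum_i P i x / G i x = E.
Local Notation a := (logd G).

Lemma smooth_logd i k : smooth_on B (a i k).
Proof.
apply: smooth_div => //; [exact: box_open|exact: G0|exact: smooth_partial].
Qed.

Let beta k i x := a i k x * (G k x / G i x).

Let sbeta k i : smooth_on B (beta k i).
Proof.
have oB := box_open hK.
by apply: smoothM => //; [exact: smooth_logd|apply: smooth_div => //; exact: G0].
Qed.

(** Differentiate [sumP] in x_k: among the P_i only P_k varies, so the result can be solved for its
    derivative. *)
Lemma partial_separated k x : B x ->
  partial k (P k) x = \sum_i beta k i x * P i x.
Proof.
move=> Bx; have oB := box_open hK.
have sPG i : smooth_on B (fun x => P i x / G i x).
  by apply: smooth_div => //; exact: G0.
have : partial k (fun y => \sum_i P i y / G i y) x = 0.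
  by rewrite (partial_ext hK k Bx sumP) partial_cst.
rewrite (partial_sum hK _ sPG Bx).
have pd i : partial k (fun y => P i y / G i y) x = partial k (P i) x / G i x - a i k x * P i x / G i x.
  rewrite (partial_div hK _ (sP i) (sG i) (G0 i) Bx) /logd.
  by field; exact: G0.
under eq_bigr do rewrite pd.
rewrite sumrB (bigD1 k) //= big1 ?addr0; last first.
  by move=> i ik; rewrite (dep_partial0 hK (@dP i)) ?mul0r // inE eq_sym.
move=> /eqP; rewrite subr_eq0 => /eqP eqk.
rewrite -[LHS](divfK (G0 k Bx)) eqk mulr_suml; apply: eq_bigr => i _.
by rewrite /beta; ring.
Qed.

(* Each derivative P_k' = sum_i beta_k^i P_i does not depend on x_l for l <> k;
   differentiating this identity in x_l gives the relation.  Its coefficients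
   no longer involve the P_i, hence not the parameters of the integral either. *)
Lemma staeckel_relation k l x : l != k -> B x ->
  \sum_i (partial l (a i k) x + a i k x * a k l x - a i k x * a i l x
          + a l k x * a i l x) * (G k x / G i x) * P i x = 0.
Proof.
move=> lk Bx; have oB := box_open hK.
have sbP i : smooth_on B (fun y => beta k i y * P i y) by exact: smoothM.
have : partial l (partial k (P k)) x = 0.
  by apply: (dep_partial0 hK (dep_partial hK k (@dP k)) _ Bx); rewrite inE.
rewrite (partial_ext hK l Bx (partial_separated k)) (partial_sum hK _ sbP Bx).
under eq_bigr do rewrite (partialM l (sbeta k _) (sP _) Bx).
rewrite big_split /= [X in _ + X](bigD1 l) //= [X in _ + (_ + X)]big1 ?addr0; last first.
  by move=> i il; rewrite (dep_partial0 hK (@dP i)) ?mulr0 // inE eq_sym.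
rewrite (partial_separated _ Bx) mulr_sumr -big_split /= => eq0.
rewrite -[RHS]eq0.
apply: eq_bigr => i _; rewrite [X in _ = _ + X]mulrA -mulrDl; congr (_ * _).
have sGG : smooth_on B (fun x => G k x / G i x) by apply: smooth_div => //; exact: G0.
rewrite (partialM l (smooth_logd i k) sGG Bx).
rewrite (partial_div hK _ (sG k) (sG i) (G0 i) Bx) /beta.
rewrite -[partial l (G k) x](divfK (G0 k Bx)) -[partial l (G i) x](divfK (G0 i Bx)).
rewrite -!/(logd G _ _ _).
by field; rewrite !G0.
Qed.

End Staeckel.

(* The gradients of the p_i are independent, so differentiating in c gives
   v_i p_i = 0; a p_i vanishing on C would have zero gradient. *)
Lemma sum_sqr_eq0 (R : realType) (n : nat) (C : set 'rV[R]_n)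
    (p : 'I_n -> 'rV[R]_n -> R) (v : 'I_n -> R) :
  open C -> C !=set0 -> (forall i c, C c -> differentiable (p i) c) ->
  (forall c, C c -> \det (\matrix_(i, j) partial j (p i) c) != 0) ->
  (forall c, C c -> \sum_i v i * p i c ^+ 2 = 0) -> forall i, v i = 0.
Proof.
move=> oC [c0 Cc0] dp detp sum0 i.
have dpj j k c : C c -> derivable (p j) c (delta_mx 0 k).
  by move=> Cc; exact/diff_derivable/dp.
have vp c : C c -> v i * p i c = 0.
  move=> Cc; pose N : 'M[R]_n := \matrix_(i, j) partial j (p i) c.
  have Nu : N \in unitmx by rewrite unitmxE unitfE; exact: detp.
  pose u : 'rV[R]_n := \row_j (v j * p j c).
  suff : u *m N = 0.
    move=> /(congr1 (mulmx^~ (invmx N))); rewrite mulmxK // mul0mx.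
    by move=> /rowP/(_ i); rewrite !mxE.
  apply/rowP => k; rewrite !mxE.
  have : partial k (fun b => \sum_j v j * p j b ^+ 2) c = 0.
    by rewrite /partial (eq_derive _ oC Cc sum0); exact: derive_cst.
  have pj2 j : derivable (p j ^+ 2) c (delta_mx 0 k) by exact: derivableX (dpj _ _ _ Cc).
  rewrite (_ : (fun b => _) = \sum_j v j *: (p j ^+ 2)); last first.
    by apply/funext => b; rewrite fct_sumE.
  rewrite /partial derive_sum; last by move=> j; exact: derivableZ.
  have D2 j : 'D_(delta_mx 0 k) (v j *: (p j ^+ 2)) c = 2 * (u 0 j * N j k).
    rewrite deriveZ // deriveX; last exact: dpj.
    by rewrite !mxE /partial /GRing.scale /= expr1; ring.
  under eq_bigr do rewrite D2.
  by rewrite -mulr_sumr => /eqP; rewrite mulf_eq0 pnatr_eq0 /= => /eqP.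
apply: contrapT => /eqP vi0.
have p0 c : C c -> p i c = cst 0 c.
  by move=> /vp /eqP; rewrite mulf_eq0 (negbTE vi0) => /eqP.
have /negP := detp _ Cc0; apply; apply/eqP.
rewrite (expand_det_row _ i) big1 // => j _.
by rewrite mxE /partial (eq_derive _ oC Cc0 p0) derive_cst mul0r.
Qed.

Lemma invmx_diag (F : fieldType) (n : nat) (d : 'rV[F]_n) :
  (forall i, d 0 i != 0) -> invmx (diag_mx d) = diag_mx (\row_i (d 0 i)^-1).
Proof.
move=> d0; have dd : diag_mx d *m diag_mx (\row_i (d 0 i)^-1) = 1%:M.
  rewrite mulmx_diag -diag_const_mx; congr diag_mx.
  by apply/rowP => i; rewrite !mxE mulfV.
have [du _] := mulmx1_unit dd.
by rewrite -[LHS]mulmx1 -dd mulmxA mulVmx // mul1mx.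
Qed.

(** * The Levi-Civita and curvature equations *)

Section HamiltonJacobi.
Context (R : realType) (n : nat) (J : 'I_n -> set R).
Hypothesis hJ : open_intervals J.
Local Notation B := (box J).
Variables (g : 'rV[R]_n -> 'M[R]_n) (G : 'I_n -> 'rV[R]_n -> R).
Hypothesis sG : forall i, smooth_on B (G i).
Hypothesis G0 : forall i x, B x -> G i x != 0.
Hypothesis gG : forall x, B x -> g x = diag_mx (\row_i G i x).
Local Notation a := (logd G).

Lemma invmx_metric x i j : B x ->
  invmx (g x) i j = if i == j then (G i x)^-1 else 0.
Proof.
move=> Bx; rewrite gG // invmx_diag; last by move=> k; rewrite mxE; exact: G0.
by rewrite !mxE; case: eqP => //= _; rewrite mulr0n.
Qed.

(* The Levi-Civita equations of both kinds: the first kind is the case where i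
   is k or l. *)
Lemma levi_civita (hsep : separable_coordinates B g) i k l x :
  l != k -> B x ->
  partial l (a i k) x + a i k x * a k l x - a i k x * a i l x
  + a l k x * a i l x = 0.
Proof.
move=> lk Bx.
have [K [C [W [E [[hK Kx KB] [oC C0 sW hW]]]]]] := hsep x Bx.
pose Wt i (z : R * 'rV[R]_n) := W i z.1 z.2.
pose w i : R * 'rV[R]_n -> R := 'D_((1, 0) : R * 'rV[R]_n) (Wt i).
have sw j : smooth_on (K j `*` C) (w j) by exact: smooth_derive (sW j).
have pW j y c : box K y -> C c ->
    partial j (fun y => \sum_i W i (y 0 i) c) y = w j (y 0 j, c).
  move=> Ky Cc.
  pose L m (z : 'rV[R]_n) : R * 'rV[R]_n := (z 0 m, c).
  have hL m h : L m (h *: delta_mx 0 j + y) =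
      h *: ((if m == j then (1, 0) else 0) : R * 'rV[R]_n) + L m y.
    rewrite /L !mxE eqxx /=; case: eqP => _.
      by congr pair; rewrite /= ?scaler0 ?add0r.
    by rewrite mulr0 scaler0 !add0r.
  rewrite (_ : (fun z : 'rV[R]_n => _) = \sum_m (Wt m \o L m)); last first.
    by apply/funext => z; rewrite fct_sumE.
  rewrite /partial derive_sum; last first.
    move=> m; apply: (derivable_comp_line (hL m)).
    by apply: smooth_derivable (sW m) _; split => //=; exact: Ky.
  rewrite (bigD1 j) //= big1 ?addr0; last first.
    move=> m mj; rewrite (derive_comp_line (Wt m) (hL m)) (negbTE mj).
    exact: derive0.
  by rewrite (derive_comp_line (Wt j) (hL j)) eqxx.
(* The Levi-Civita expressions at [x], weighted as in [staeckel_relation]. They do not involve [c],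
   which is what lets [sum_sqr_eq0] apply. *)
pose v j := (partial l (a j k) x + a j k x * a k l x - a j k x * a j l x
          + a l k x * a j l x) * (G k x / G j x).
have oK := box_open hK.
suff v0 : forall j, v j = 0.
  have /eqP := v0 i; rewrite /v mulf_eq0 => /orP[/eqP//|].
  by rewrite mulf_eq0 invr_eq0 !(negbTE (G0 _ _)).
apply: (@sum_sqr_eq0 _ _ C (fun i c => w i (x 0 i, c))) => //.
- move=> j c Cc; apply: (@differentiable_comp _ _ _ _ (fun c => (x 0 j, c)) (w j)).
    exact: differentiable_pair.
  by apply: smooth_differentiable (sw j) _; split => //; exact: Kx.
- move=> c Cc; have [_] := hW x c Kx Cc.
  set M1 := (X in \det X != _ -> _); set M2 := (X in _ -> \det X != _).
  suff -> : M1 = M2 by [].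
  apply/matrixP => p q; rewrite [LHS]mxE [RHS]mxE.
  apply: (eq_derive _ oC Cc) => b Cb.
  exact: pW.
move=> c Cc.
(* With P_j the square of W_j', the Hamilton-Jacobi equation reads sum_j P_j / G_j = 2 E. *)
pose P j (y : 'rV[R]_n) := w j (y 0 j, c) ^+ 2.
have sP j : smooth_on (box K) (P j).
  pose L (y : 'rV[R]_n) : R * 'rV[R]_n := (y 0 j, c).
  pose L0 (y : 'rV[R]_n) : R * 'rV[R]_n := (y 0 j, 0).
  have swL : smooth_on (box K) (fun y => w j (L y)).
    apply: (@smooth_comp _ _ _ _ (K j `*` C) _ L L0) => //.
    - by move=> y u h; rewrite /L /L0 !mxE; congr pair; rewrite /= scaler0 add0r.
    - move=> y Ky; apply: differentiable_pair => //.
      exact: differentiable_coord.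
  by apply: (smooth_ext oK _ (smoothM oK swL swL)) => y _; rewrite /P expr2.
have dP j : depends_only_on [set j]%SET (box K) (P j).
  by move=> y z _ _ yz; rewrite /P yz // inE.
have sumP y : box K y -> \sum_i P i y / G i y = 2 * E c.
  move=> Ky; have [+ _] := hW y c Ky Cc.
  rewrite (eq_bigr (fun i => P i y / G i y)).
    by move=> <-; rewrite mulrA mulfV ?mul1r // pnatr_eq0.
  move=> j _; rewrite (bigD1 j) //= big1 ?addr0.
    by rewrite (invmx_metric _ _ (KB _ Ky)) eqxx pW // /P; ring.
  move=> m mj; rewrite (invmx_metric _ _ (KB _ Ky)) eq_sym (negbTE mj).
  by rewrite !mul0r.
apply: (staeckel_relation hK _ _ sP dP sumP lk Kx).
- by move=> j; apply: smooth_sub (sG j).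
- by move=> j y Ky; apply: G0; exact: KB.
Qed.

Lemma christoffel_metric m i j x : B x ->
  christoffel g m i j x =
  2^-1 * ((if j == m then partial i (G j) x else 0)
          + (if i == m then partial j (G i) x else 0)
          - (if i == j then partial m (G i) x else 0)) / G m x.
Proof.
move=> Bx; rewrite /christoffel (bigD1 m) //= [X in _ + X]big1 ?addr0; last first.
  by move=> p pm; rewrite invmx_metric // eq_sym (negbTE pm) mul0r.
have pg p q r : partial r (fun y => g y p q) x = if p == q then partial r (G p) x else 0.
  rewrite (@partial_ext _ _ _ hJ _ _ (fun y => if p == q then G p y else 0)) //.
    by case: eqP => // _; rewrite partial_cst.
  by move=> y By; rewrite gG // !mxE; case: eqP => //= _; rewrite mulr0n.
by rewrite invmx_metric // eqxx !pg mulrC; ring.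
Qed.

(** Only the term [m = i] survives lowering the index. In it Gamma^i_kj vanishes for distinct
    indices, Gamma^i_ij is a_ij / 2, and the quadratic sum reduces to the indices i, j, k. The
    factor 4 clears denominators. *)
Lemma riemann_metric i j k x : i != j -> i != k -> j != k -> B x ->
  4 * riemann g i j i k x = - G i x * (2 * partial k (a i j) x
    + a i k x * a i j x - a i j x * a j k x - a i k x * a k j x).
Proof.
move=> ij ik jk Bx.
have [ji ki kj] : [/\ j != i, k != i & k != j].
  by split; rewrite eq_sym.
have E := (negbTE ij, negbTE ik, negbTE jk, negbTE ji, negbTE ki, negbTE kj).
rewrite /riemann (bigD1 i) //= [X in _ * (_ + X)]big1 ?addr0; last first.
  by move=> m mi; rewrite gG // !mxE eq_sym (negbTE mi) mulr0n mul0r.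
rewrite gG // !mxE eqxx mulr1n.
have -> : partial i (christoffel g i k j) x = 0.
  rewrite (@partial_ext _ _ _ hJ _ _ (fun=> 0)) ?partial_cst // => y By.
  by rewrite christoffel_metric // !E; ring.
have -> : partial k (christoffel g i i j) x = 2^-1 * partial k (a i j) x.
  have sa := smooth_logd hJ sG G0 i j.
  rewrite (@partial_ext _ _ _ hJ _ _ (fun y => 2^-1 * a i j y)) //.
    rewrite (partialM k (smooth_cst 2^-1) sa Bx).
    by rewrite partial_cst mul0r add0r.
  by move=> y By; rewrite christoffel_metric // !E eqxx /logd; ring.
rewrite (bigD1 i) //= (bigD1 j) //= (bigD1 k) /=; last by rewrite ki kj.
rewrite big1 ?addr0; last first.
  move=> m /andP[/andP[mi mj] mk].
  rewrite !christoffel_metric // !E.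
  by rewrite ![_ == m]eq_sym (negbTE mi) (negbTE mj) (negbTE mk); ring.
rewrite !christoffel_metric // !E !eqxx.
have e p q : partial q (G p) x = a p q x * G p x by rewrite divfK // G0.
rewrite !e; move: (partial k (a i j) x) (G0 i Bx) (G0 j Bx) (G0 k Bx).
move: (G i x) (G j x) (G k x) => gi gj gk D gi0 gj0 gk0.
move: (a i j x) (a i k x) (a j k x) (a k j x) (a j i x) (a k i x) => ? ? ? ? ? ?.
by field; rewrite gi0 gj0 gk0.
Qed.

End HamiltonJacobi.

(** * Diagonal metrics in block form *)

Lemma diag_mx_block (R : realType) (n : nat) (d : 'rV[R]_n)
    (M : {set 'I_n}) (P : {set {set 'I_n}}) (phi : 'I_n -> R)
    (c : {set 'I_n} -> R) (f : {set 'I_n} -> 'I_n -> 'I_n -> 'rV[R]_n -> R) x :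
  finset.partition P (~: M)%SET ->
  (forall i, i \in M -> d 0 i = phi i) ->
  (forall I i, I \in P -> i \in I -> d 0 i = c I * f I i i x) ->
  (forall I i j, I \in P -> i \in I -> i != j -> f I i j x = 0) ->
  diag_mx d = \sum_(i in M) phi i *: delta_mx i i
              + \sum_(I in P) c I *: block_tensor I (f I) x.
Proof.
move=> PM dM dP f0; rewrite diag_mx_sum_delta (bigID (mem M)) /=; congr (_ + _).
  by apply: eq_bigr => i iM; rewrite dM.
rewrite (eq_bigl (fun i => i \in ~: M)%SET); last by move=> i; rewrite inE.
rewrite (set_partition_big _ PM); apply: eq_bigr => I IP.
rewrite /block_tensor scaler_sumr; apply: eq_bigr => i iI.
rewrite (bigD1 i) //= big1 ?addr0; last first.
  by move=> j /andP[_ ji]; rewrite f0 ?scale0r // eq_sym.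
by rewrite scalerA -(dP I).
Qed.

Definition diag_coef (R : realType) (n : nat)
    (F : {set 'I_n} -> 'I_n -> 'rV[R]_n -> R) (I : {set 'I_n}) (i j : 'I_n)
    (x : 'rV[R]_n) : R := if i == j then F I i x else 0.

Lemma block_diag_coef (R : realType) (n : nat) (D : set 'rV[R]_n)
    (F : {set 'I_n} -> 'I_n -> 'rV[R]_n -> R) (I : {set 'I_n}) :
  (forall i, i \in I -> smooth_on D (F I i) /\ depends_only_on I D (F I i)) ->
  block_coefficients D I (diag_coef F I).
Proof.
move=> hF i j iI jI; rewrite /diag_coef; case: eqP => _; first exact: hF.
by split; [exact: smooth_cst|].
Qed.

(** The first equation, on the diagonal, combines the second with the symmetry d_l a_kk = d_k a_kl;
    it serves to integrate in a coordinate plane. *)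
Definition logd_system (R : realType) (n : nat) (B : set 'rV[R]_n)
    (a : 'I_n -> 'I_n -> 'rV[R]_n -> R) : Prop :=
  [/\ forall k l x, l != k -> B x -> partial l (a k k) x = - (a l k x * a k l x),
      forall i k x, i != k -> B x -> partial i (a i k) x = - (a i k x * a k i x),
      forall i j k x, i != j -> i != k -> j != k -> B x ->
        partial k (a i j) x = 0
    & forall i j k x, i != j -> i != k -> j != k -> B x ->
        a i j x * a i k x = a i j x * a j k x + a i k x * a k j x].

(** * Which coordinates enter which coefficients *)

Section LogdSystem.
Context (R : realType) (n : nat) (J : 'I_n -> set R).
Hypothesis hJ : open_intervals J.
Local Notation B := (box J).
Variable G : 'I_n -> 'rV[R]_n -> R.
Hypothesis sG : forall i, smooth_on B (G i).
Hypothesis G0 : forall i x, B x -> G i x != 0.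
Local Notation a := (logd G).
Hypothesis sysG : logd_system B a.

Let oB := box_open hJ.
Let sa i k : smooth_on B (a i k) := smooth_logd hJ sG G0 i k.

Lemma partial_logd i k x : B x -> partial k (G i) x = a i k x * G i x.
Proof. by move=> Bx; rewrite /logd divfK // G0. Qed.

Lemma logd_dep i j : i != j -> depends_only_on [set i; j]%SET B (a i j).
Proof.
move=> ij; apply: (partial0_dep hJ (sa i j)) => k z; rewrite !inE negb_or.
move=> /andP[ki kj] Bz; have [_ _ h _] := sysG.
by apply: h => //; rewrite eq_sym.
Qed.

(** In the x_i-derivative the terms - a_ij a_ji G_j, from the second equation of the system, and
    a_ij a_ji G_j, from d_i G_j, cancel. *)
Lemma logdG_const i j x y : i != j -> B x -> B y ->
  (forall k, k != i -> x 0 k = y 0 k) -> a i j x * G j x = a i j y * G j y.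
Proof.
move=> ij Bx By xy.
apply: (@partial0_line _ _ _ hJ (fun x => a i j x * G j x) i) => //.
  exact: smoothM.
move=> z Bz; rewrite (partialM i (sa i j) (sG j) Bz) partial_logd //.
by have [_ -> // _ _] := sysG; ring.
Qed.

(* Since a_ij G_j does not depend on x_i, the zero set of a_ij is determined by
   x_j alone; this replaces uniqueness for linear differential equations. *)
Lemma logd_neq0 i j x y : i != j -> B x -> B y -> x 0 j = y 0 j ->
  a i j x != 0 -> a i j y != 0.
Proof.
move=> ij Bx By xyj ax0; pose z := mix [set~ i]%SET x y.
have Bz : B z by exact: box_mix.
have : a i j z * G j z != 0.
  rewrite -(logdG_const ij Bx Bz).
    by apply: mulf_neq0 => //; exact: G0.
  by move=> k ki; rewrite mixE !inE ki.
rewrite mulf_eq0 negb_or => /andP[+ _].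
rewrite (logd_dep ij Bz By) // => k; rewrite !inE mixE !inE.
by move=> /orP[/eqP->|/eqP->]; rewrite ?eqxx // eq_sym ij.
Qed.

Definition affects (j i : 'I_n) : Prop := exists x, B x /\ a i j x != 0.

Lemma not_affects i j x : ~ affects j i -> B x -> a i j x = 0.
Proof.
move=> na Bx; apply: contrapT => /eqP ax0; apply: na; by exists x.
Qed.

(** By [logd_neq0] the first condition depends on x_j alone and the second on x_l alone, so the two
    witnesses can be spliced. *)
Lemma affects_at i j k l : i != j -> k != l -> j != l ->
  affects j i -> affects l k -> exists x, [/\ B x, a i j x != 0 & a k l x != 0].
Proof.
move=> ij kl jl [x [Bx ax]] [y [By ay]]; exists (mix [set j]%SET x y).
have Bz : B (mix [set j]%SET x y) by exact: box_mix.
split=> //.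
  by apply: logd_neq0 ax => //; rewrite mixE inE eqxx.
by apply: logd_neq0 ay => //; rewrite mixE inE eq_sym (negbTE jl).
Qed.

(** Where a_kj and a_ji are both nonzero, a zero of a_ki would contradict the quadratic relation for
    (k, j, i). *)
Lemma affects_trans i j k : i != j -> j != k -> i != k ->
  affects i j -> affects j k -> affects i k.
Proof.
move=> ij jk ik aij ajk.
have [ji kj ki] : [/\ j != i, k != j & k != i] by split; rewrite eq_sym.
have [z [Bz z1 z2]] := affects_at ji kj ij aij ajk.
exists z; split=> //; have [_ _ _ /(_ k j i z kj ki ji Bz) h] := sysG.
apply/eqP => z0; move: h; rewrite z0 mulr0 mul0r addr0 => /esym/eqP.
by rewrite mulf_eq0 (negbTE z1) (negbTE z2).
Qed.

(** Where a_ki and a_kj are both nonzero, the quadratic relation for (k, i, j) keeps a_ij and a_ji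
    from vanishing together. *)
Lemma affects_comparable i j k : i != j -> j != k -> i != k ->
  affects i k -> affects j k -> affects i j \/ affects j i.
Proof.
move=> ij jk ik aik ajk.
have [kj ki] : k != j /\ k != i by split; rewrite eq_sym.
have [z [Bz z1 z2]] := affects_at ki kj ij aik ajk.
have [_ _ _ /(_ k i j z ki kj ij Bz) h] := sysG.
have [nij|] := pselect (affects i j); first by left.
move=> nij; right; exists z; split=> //; apply/eqP => z0.
move: h; rewrite z0 (not_affects nij Bz) !mulr0 addr0 => /eqP.
by rewrite mulf_eq0 (negbTE z1) (negbTE z2).
Qed.

Definition affects_eq (j i : 'I_n) : bool := (j == i) || `[< affects j i >].

Lemma affects_eqP j i : affects_eq j i -> j != i -> affects j i.
Proof. by move=> /orP[/eqP->|/asboolP //]; rewrite eqxx. Qed.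

Lemma affects_eqW j i : affects j i -> affects_eq j i.
Proof. by move=> ?; apply/orP; right; exact/asboolP. Qed.

Lemma affects_eq_refl i : affects_eq i i.
Proof. by rewrite /affects_eq eqxx. Qed.

Lemma affects_eq_trans i j k : affects_eq i j -> affects_eq j k -> affects_eq i k.
Proof.
have [->//|ij] := eqVneq i j; have [->//|jk] := eqVneq j k.
have [->|ik] := eqVneq i k; first by move=> _ _; exact: affects_eq_refl.
move=> /affects_eqP/(_ ij) aij /affects_eqP/(_ jk) ajk.
by apply: affects_eqW; exact: affects_trans ij jk ik aij ajk.
Qed.

Lemma affects_eq_comparable i j k : affects_eq i k -> affects_eq j k ->
  affects_eq i j \/ affects_eq j i.
Proof.
have [->|ij] := eqVneq i j; first by left; exact: affects_eq_refl.
have [->|jk] := eqVneq j k; first by left.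
have [->|ik] := eqVneq i k; first by right.
move=> /affects_eqP/(_ ik) aik /affects_eqP/(_ jk) ajk.
have [|] := affects_comparable ij jk ik aik ajk.
  by left; exact: affects_eqW.
by right; exact: affects_eqW.
Qed.

(** Take [r] affecting as many coordinates as possible. If [m] affects [r], the set below [m]
    contains the set below [r]; by cardinality they coincide, and [m] is in both. *)
Lemma exists_root (i0 : 'I_n) : exists r, forall m, affects_eq m r -> affects_eq r m.
Proof.
pose D r := [set k | affects_eq r k]%SET.
case: (@arg_maxnP _ i0 xpredT (fun r => #|D r|)) => // r _ rmax.
have inD j k : (k \in D j) = affects_eq j k by rewrite /D finset.in_set.
clearbody D.
exists r => m mr; have Dsub : D r \subset D m.
  by apply/fintype.subsetP => k; rewrite 2!inD; exact: affects_eq_trans.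
have /eqP DE : D r == D m by rewrite eqEcard Dsub; exact: rmax.
by rewrite -inD DE inD affects_eq_refl.
Qed.

(** If [m] affects [k], it is comparable with [r], and either order puts it below [r] by maximality;
    if [k] affects [m], transitivity does. *)
Lemma root_closed r m k : (forall m, affects_eq m r -> affects_eq r m) ->
  affects_eq r k -> ~~ affects_eq r m -> ~ affects m k /\ ~ affects k m.
Proof.
move=> rr rk rm; split=> [mk|km].
  have [/rr|] := affects_eq_comparable (affects_eqW mk) rk; exact/negP.
by apply/negP: rm; rewrite (affects_eq_trans rk) // affects_eqW.
Qed.

End LogdSystem.

(* For f depending on x_c only, slice p c f is f as a function of one variable. *)
Definition slice (R : realType) (n : nat) (p : 'rV[R]_n) (c : 'I_n)
    (f : 'rV[R]_n -> R) (t : R) : R := f (mix [set c]%SET (const_mx t) p).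

Section Slice.
Context (R : realType) (n : nat) (J : 'I_n -> set R).
Hypothesis hJ : open_intervals J.
Local Notation B := (box J).
Variables (p : 'rV[R]_n) (c : 'I_n) (f : 'rV[R]_n -> R).
Hypothesis Bp : B p.

Lemma box_slice t : J c t -> B (mix [set c]%SET (const_mx t) p).
Proof.
by move=> Jt i; rewrite mixE inE; have [->|_] := eqVneq i c; rewrite ?mxE.
Qed.

Lemma slice_smooth : smooth_on B f -> smooth_on (J c) (slice p c f).
Proof.
pose L (t : R) : 'rV[R]_n := mix [set c]%SET (const_mx t) p.
pose L0 (t : R) : 'rV[R]_n := t *: delta_mx 0 c.
have hL t v (h : R) : L (h *: v + t) = h *: L0 v + L t.
  apply/rowP => i; rewrite !mxE !inE eqxx /=.
  by have [_|_] := eqVneq i c; rewrite ?mulr1 // !mulr0 add0r.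
apply: (smooth_comp hL); first exact: box_slice.
move=> t _; rewrite (_ : L = L0 + cst (L 0)).
  by apply: differentiableD => //; apply: differentiableZl.
by apply/funext => u; have := hL 0 u 1; rewrite !scale1r addr0.
Qed.

Lemma sliceE x : depends_only_on [set c]%SET B f -> B x ->
  slice p c f (x 0 c) = f x.
Proof.
move=> df Bx; apply: df => //; first exact/box_slice/Bx.
by move=> i; rewrite inE => /eqP ->; rewrite mixE inE eqxx mxE.
Qed.

Lemma slice_nonconstant x : depends_only_on [set c]%SET B f -> B x ->
  partial c f x != 0 -> nonconstant_on (J c) (slice p c f).
Proof.
move=> df Bx fx; apply: contrapT => nc; move/negP: fx; apply; apply/eqP.
rewrite (@partial_ext _ _ _ hJ _ _ (fun=> f x)) ?partial_cst // => y By.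
apply: contrapT => /eqP fyx; apply: nc; exists (y 0 c), (x 0 c).
by rewrite !sliceE.
Qed.

End Slice.

(** * Blocks of a partition *)

Lemma mem_partition_block (T : finType) (P : {set {set T}}) (D I : {set T}) i :
  finset.partition P D -> I \in P -> i \in I -> i \in D.
Proof.
move=> PD IP iI; rewrite -(cover_partition PD).
by apply/finset.bigcupP; exists I.
Qed.

Lemma mem_pick_block (T : finType) (P : {set {set T}}) (D I : {set T}) (t : T) :
  finset.partition P D -> I \in P -> odflt t [pick i in I] \in I.
Proof.
move=> PD IP; case: pickP => //= I0; have [_ _ /negP] := and3P PD; case.
rewrite (_ : finset.set0 = I) //.
by apply/finset.setP => i; rewrite inE; exact/esym/I0.
Qed.

Lemma equivalence_partition_block (T : finType) (e : rel T) (D I : {set T}) i j :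
  {in D & &, equivalence_rel e} -> I \in equivalence_partition e D ->
  i \in I -> j \in D -> (j \in I) = e i j.
Proof.
move=> eqe /imsetP[m mD ->]; rewrite !inE => /andP[iD mi] jD; rewrite jD /=.
exact: (eqe m i j mD iD jD).2.
Qed.

(** * Products and warped products over one coordinate *)

Section Forms.
Context (R : realType) (n : nat) (J : 'I_n -> set R).
Hypothesis hJ : open_intervals J.
Local Notation B := (box J).
Variables (g : 'rV[R]_n -> 'M[R]_n) (G : 'I_n -> 'rV[R]_n -> R).
Hypothesis sG : forall i, smooth_on B (G i).
Hypothesis G0 : forall i x, B x -> G i x != 0.
Hypothesis gG : forall x, B x -> g x = diag_mx (\row_i G i x).
Local Notation a := (logd G).
Hypothesis sysG : logd_system B a.

Let oB := box_open hJ.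
Let sa i k : smooth_on B (a i k) := smooth_logd hJ sG G0 i k.
Let pG i k x : B x -> partial k (G i) x = a i k x * G i x :=
  @partial_logd _ _ _ _ G0 i k x.

(** With [M] empty all products are 1, and the form is a direct product over [D] and its complement,
    both nonempty thanks to [k0] and [m0]. *)
Lemma form1_product (D : {set 'I_n}) k0 m0 : k0 \in D -> m0 \notin D ->
  (forall k m, k \in D -> m \notin D ->
     ~ affects J G m k /\ ~ affects J G k m) ->
  form1 J g.
Proof.
move=> kD mD nD; have DC : D != (~: D)%SET.
  by apply/eqP => /setP/(_ k0); rewrite inE kD.
have PD : finset.partition [set D; ~: D]%SET (~: finset.set0)%SET.
  apply/and3P; split.
  - apply/eqP/finset.setP => i; rewrite !inE; apply/finset.bigcupP.
    exists (if i \in D then D else ~: D)%SET; case: ifP => iD;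
      by rewrite ?inE ?iD ?eqxx ?orbT.
  - apply/finset.trivIsetP => X Y; rewrite !inE => /orP[]/eqP-> /orP[]/eqP->;
      by rewrite ?eqxx // => _; rewrite -finset.setI_eq0 ?finset.setICr // finset.setIC finset.setICr.
  - rewrite !inE negb_or; apply/andP; split; apply/eqP => /finset.setP.
      by move=> /(_ k0); rewrite inE kD.
    by move=> /(_ m0); rewrite !inE mD.
exists finset.set0, [set D; ~: D]%SET, (fun _ _ => 0), (fun _ _ => 0), (fun=> 0).
exists (diag_coef (fun _ => G)); split=> //.
- by right; rewrite cards2 DC.
- by move=> i; rewrite inE.
- move=> I IP; apply: block_diag_coef => i iI; split=> //.
  apply: partial0_dep => // k z kI Bz; rewrite pG // (not_affects _ Bz) ?mul0r //.
  move: IP iI kI; rewrite !inE => /orP[]/eqP->; first by move=> /nD h /h[].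
  by rewrite !inE negbK => iI kI; have [] := nD _ _ kI iI.
move=> x Bx; rewrite gG //; apply: diag_mx_block => //.
- by move=> i; rewrite inE.
- by move=> I i _ _; rewrite big_set0 mul1r mxE /diag_coef eqxx.
- by move=> I i j _ _ /negbTE ij; rewrite /diag_coef ij.
Qed.

Section Warped.
Variable r : 'I_n.
Hypothesis rall : forall i, i != r -> affects J G r i.
Hypothesis rnone : forall i, i != r -> ~ affects J G i r.

Let ar0 i x : i != r -> B x -> a r i x = 0.
Proof. by move=> /rnone; exact: not_affects. Qed.

Lemma warp_dep i : i != r -> depends_only_on [set r]%SET B (a i r).
Proof.
move=> ir; apply: partial0_dep => // k z; rewrite inE => kr Bz.
have [_ e1 e2 _] := sysG; have [->|ki] := eqVneq k i.
  by rewrite e1 // ar0 // mulr0 oppr0.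
by apply: e2 => //; rewrite eq_sym.
Qed.

(** As a_rk = 0, the quadratic relation for (i, k, r) reads a_ik a_ir = a_ik a_kr. If a_ik were
    nonzero somewhere, it would stay so after moving x_r to its value at [y], where a_ir and a_kr
    differ. *)
Lemma warp_unlinked i k : i != r -> k != r -> i != k ->
  (exists2 y, B y & a i r y <> a k r y) -> ~ affects J G k i.
Proof.
move=> ir kr ik [y By ay] [x [Bx ax]]; apply: ay.
pose z := mix [set r]%SET y x; have Bz : B z by exact: box_mix.
have az : a i k z != 0.
  by apply: (logd_neq0 hJ sG G0 sysG ik Bx Bz) ax; rewrite mixE inE (negbTE kr).
have zy j : j != r -> a j r z = a j r y.
  by move=> jr; apply: warp_dep => // l; rewrite inE => /eqP->; rewrite mixE inE eqxx.
rewrite -!zy //; apply: (mulfI az).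
have [_ _ _ /(_ i k r z ik ir kr Bz) ->] := sysG.
by rewrite (ar0 kr Bz) mulr0 addr0.
Qed.

(** The blocks are the classes of coordinates with the same a_ir; within one, all coefficients vary
    with x_r by the same factor. *)
Lemma form2_warped : form2 J g.
Proof.
have [p Bp] := box_point hJ.
pose eqa i j := `[< forall x, B x -> a i r x = a j r x >].
pose P := equivalence_partition eqa [set~ r]%SET.
have eqaE : {in [set~ r]%SET & &, equivalence_rel eqa}.
  move=> i j k _ _ _; split; first exact/asboolP.
  move=> /asboolP ij; apply/asboolP/asboolP => h x Bx.
    by rewrite -ij // h.
  by rewrite ij // h.
have PP : finset.partition P [set~ r]%SET by exact: equivalence_partitionP.
have Pr I i : I \in P -> i \in I -> i != r.
  by move=> IP /(mem_partition_block PP IP); rewrite !inE.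
have PE I i j : I \in P -> i \in I -> j != r -> (j \in I) = eqa i j.
  by move=> IP iI jr; apply: equivalence_partition_block eqaE IP iI _; rewrite !inE.
pose rep (I : {set 'I_n}) := odflt r [pick i in I].
have repI I : I \in P -> rep I \in I by exact: mem_pick_block PP.
(* The warping factor: the coefficient of a representative, with all coordinates but x_r frozen at
   [p]. *)
pose S I x := G (rep I) (mix [set r]%SET x p).
have sS I : smooth_on B (S I) by exact: smooth_mix.
have S0 I x : B x -> S I x != 0 by move=> Bx; apply: G0; exact: box_mix.
have dS I : depends_only_on [set r]%SET B (S I).
  move=> x y Bx By xy; congr (G _ _); apply/rowP => i; rewrite !mixE.
  by case: ifP => // /xy.
pose F I i x := G i x / S I x.
have sF I i : smooth_on B (F I i) by apply: smooth_div => //; exact: S0.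
have Sr I x : B x -> I \in P -> partial r (S I) x = a (rep I) r x * S I x.
  move=> Bx IP; rewrite (partial_mix [set r]%SET p (G (rep I))) inE eqxx pG; last exact: box_mix.
  congr (_ * _); apply: warp_dep => //; [exact: Pr IP (repI _ IP)|exact: box_mix|].
  by move=> i; rewrite inE => /eqP->; rewrite mixE inE eqxx.
exists r, P, (slice p r (G r)), (fun I => slice p r (S I)), (diag_coef F); split.
- exact: PP.
- exact: slice_smooth.
- move=> I IP; split; first exact: slice_smooth.
  have rI := Pr _ _ IP (repI _ IP).
  have [x [Bx ax]] := rall rI.
  apply: (slice_nonconstant hJ Bp (dS I) Bx).
  by rewrite Sr // mulf_neq0 // S0.
- move=> I IP; apply: block_diag_coef => i iI; split; first exact: sF.
  have ir := Pr _ _ IP iI.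
  apply: partial0_dep => // k z kI Bz.
  rewrite (partial_div hJ k (sG i) (sS I) (S0 I) Bz) pG //.
  (* In the direction [r] the logarithmic derivatives agree within a class and cancel; any other [k]
     lies in another class, hence does not affect [i]. *)
  have [->|kr] := eqVneq k r.
    have rI := repI _ IP; have := PE _ _ _ IP iI (Pr _ _ IP rI).
    rewrite rI Sr // => /esym/asboolP -> //.
    by rewrite [X in X / _](_ : _ = 0) ?mul0r //; ring.
  have ik : i != k by apply: contraNneq kI => <-.
  have := PE _ _ _ IP iI kr; rewrite (negbTE kI) => /esym/asboolPn.
  move=> /existsNP[y /not_implyP[By ay]].
  have nki : ~ affects J G k i by apply: warp_unlinked => //; exists y.
  rewrite (not_affects nki Bz) (dep_partial0 hJ (dS I)) ?inE //.
  by rewrite mulr0 !mul0r subr0 mul0r.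
move=> x Bx; rewrite gG //.
have Gr : slice p r (G r) (x 0 r) = G r x.
  apply: (sliceE Bp _ Bx); apply: partial0_dep => // k z; rewrite inE => kr Bz.
  by rewrite pG // ar0 // mul0r.
rewrite (diag_mx_block (M := [set r]%SET) (P := P) (phi := fun=> G r x)
  (c := fun I => S I x) (f := diag_coef F) (x := x)) //.
- rewrite big_set1 Gr; congr (_ + _); apply: eq_bigr => I IP.
  by rewrite (sliceE Bp (dS I) Bx).
- by move=> i; rewrite inE => /eqP->; rewrite mxE.
- by move=> I i _ _; rewrite mxE /diag_coef eqxx /F mulrC divfK // S0.
- by move=> I i j _ _ /negbTE ij; rewrite /diag_coef ij.
Qed.

End Warped.

End Forms.

(** * Separating functions *)

(* S c plays the role of sigma_c when it is not constant, and of e_I for c in I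
   when it is. *)
Section Separating.
Context (R : realType) (n : nat) (J : 'I_n -> set R).
Hypothesis hJ : open_intervals J.
Local Notation B := (box J).
Variables (g : 'rV[R]_n -> 'M[R]_n) (G : 'I_n -> 'rV[R]_n -> R).
Hypothesis sG : forall i, smooth_on B (G i).
Hypothesis G0 : forall i x, B x -> G i x != 0.
Hypothesis gG : forall x, B x -> g x = diag_mx (\row_i G i x).
Local Notation a := (logd G).
Variable S : 'I_n -> 'rV[R]_n -> R.
Hypothesis sS : forall c, smooth_on B (S c).
Hypothesis dS : forall c, depends_only_on [set c]%SET B (S c).

Let oB := box_open hJ.
Let pG i k x : B x -> partial k (G i) x = a i k x * G i x :=
  @partial_logd _ _ _ _ G0 i k x.
Let sBS b c : smooth_on B (fun x => S b x - S c x) := smoothB oB (sS b) (sS c).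

Lemma partial_sep b c x : B x -> c != b -> partial b (S c) x = 0.
Proof. by move=> Bx cb; apply: (dep_partial0 hJ (@dS c)); rewrite ?inE // eq_sym. Qed.

(* (S b - S c) / G c does not depend on x_b, so a zero of S b - S c would spread
   along x_b and force the derivative of S b to vanish. *)
Lemma sep_neq0 b c x y : c != b ->
  (forall x, B x -> a c b x * (S b x - S c x) = partial b (S b) x) ->
  B y -> partial b (S b) y != 0 -> B x -> S b x - S c x != 0.
Proof.
move=> cb eqS By Sy Bx; apply/eqP => Sx.
pose z := mix [set b]%SET y x; have Bz : B z by exact: box_mix.
pose q x := (S b x - S c x) / G c x.
have sq : smooth_on B q by apply: smooth_div => //; exact: G0.
have qx : q x = 0 by rewrite /q Sx mul0r.
have qz : q z = 0.
  rewrite -qx; apply: (partial0_line hJ sq (k := b)) => //.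
    move=> u Bu; rewrite (partial_div hJ _ (sBS b c) (sG c) (G0 c) Bu).
    rewrite (partialB _ (sS b) (sS c) Bu) (partial_sep Bu cb) -eqS // pG //.
    by rewrite [X in X / _](_ : _ = 0) ?mul0r //; ring.
  by move=> i ib; rewrite mixE inE (negbTE ib).
move/eqP: qz; rewrite /q mulf_eq0 invr_eq0 (negbTE (G0 _ _)) // orbF => /eqP Sz.
move/negP: Sy; apply; apply/eqP.
rewrite -(dep_partial hJ b (@dS b) Bz By); last first.
  by move=> i; rewrite inE => /eqP->; rewrite mixE inE eqxx.
by rewrite -eqS // Sz mulr0.
Qed.

(** Only the factor with b = k can vary, and its logarithmic derivative is [c]. Both products of
    form (1) are covered: [T] is S_i over [M], and the constant of the block otherwise. *)
Lemma partial_sep_prod (A : pred 'I_n) (T : 'rV[R]_n -> R) k (c : R) x :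
  smooth_on B T -> depends_only_on [set~ k]%SET B T -> B x ->
  (A k -> - partial k (S k) x = c * (T x - S k x)) -> (~~ A k -> c = 0) ->
  partial k (fun x => \prod_(b | A b) (T x - S b x)) x =
  c * \prod_(b | A b) (T x - S b x).
Proof.
move=> sT dT Bx Ak nAk.
have sprod (A' : pred 'I_n) : smooth_on B (fun x => \prod_(b | A' b) (T x - S b x)).
  by apply: smooth_prod => // b _; exact: smoothB.
have p0 (A' : pred 'I_n) : ~~ A' k ->
    partial k (fun x => \prod_(b | A' b) (T x - S b x)) x = 0.
  move=> A'k; apply: (dep_partial0 hJ (I := [set~ k]%SET)) => //; last by rewrite !inE eqxx.
  move=> y z By Bz yz; apply: eq_bigr => b A'b; congr (_ - _); first exact: dT.
  apply: dS => // i; rewrite inE => /eqP->; apply: yz; rewrite !inE.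
  by apply: contraNneq A'k => <-.
have [Akt|Akf] := boolP (A k); last by rewrite p0 // nAk // mul0r.
rewrite (@partial_ext _ _ _ hJ _ _ (fun x => (T x - S k x) *
  \prod_(b | A b && (b != k)) (T x - S b x))) //; last first.
  by move=> y _; rewrite (bigD1 k).
rewrite (partialM k (smoothB oB sT (sS k)) (sprod _) Bx).
rewrite p0 ?eqxx ?andbF // mulr0 addr0 [in RHS](bigD1 k) //= mulrA.
by rewrite (partialB _ sT (sS k) Bx) (dep_partial0 hJ dT) ?inE ?eqxx // sub0r Ak.
Qed.

Hypothesis eqS : forall b c x, c != b -> B x ->
  a c b x * (S b x - S c x) = partial b (S b) x.

(** Each G_i is divided by the product that form (1) predicts; by [eqS] the two have the same
    logarithmic derivative in every direction that the quotient must ignore. *)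
Lemma form1_separating o y : B y -> partial o (S o) y != 0 -> form1 J g.
Proof.
move=> By Soy; have [p Bp] := box_point hJ.
pose M := [set b | `[< exists x, B x /\ partial b (S b) x != 0 >]]%SET.
have MP b : b \in M -> exists x, B x /\ partial b (S b) x != 0.
  by rewrite inE => /asboolP.
have MN b x : b \notin M -> B x -> partial b (S b) x = 0.
  rewrite inE => /asboolPn nb Bx; apply: contrapT => /eqP bx; apply: nb.
  by exists x.
have oM : o \in M by rewrite inE; apply/asboolP; exists y.
have S_neq b c x : b \in M -> c != b -> B x -> S b x - S c x != 0.
  move=> /MP[z [Bz bz]] cb Bx; apply: (sep_neq0 cb _ Bz bz Bx) => u Bu.
  exact: eqS.
have S_cst i x z : i \notin M -> B x -> B z -> S i x = S i z.
  move=> iM Bx Bz; apply: (@partial0_dep _ _ _ hJ finset.set0) => //.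
    move=> k u _ Bu; have [<-|ik] := eqVneq i k; first exact: MN.
    exact: partial_sep.
  by move=> k; rewrite inE.
pose e0 i j := S i p == S j p.
pose P := equivalence_partition e0 (~: M)%SET.
have e0E : {in (~: M)%SET & &, equivalence_rel e0}.
  by move=> i j k _ _ _; split=> [|/eqP ij]; rewrite /e0 ?eqxx // ij.
have PP : finset.partition P (~: M)%SET by exact: equivalence_partitionP.
have PM I i : I \in P -> i \in I -> i \notin M.
  by move=> IP /(mem_partition_block PP IP); rewrite inE.
have PE I i j : I \in P -> i \in I -> j \notin M -> (j \in I) = e0 i j.
  move=> IP iI jM; apply: equivalence_partition_block e0E IP iI _.
  by rewrite inE.
pose rep (I : {set 'I_n}) := odflt o [pick i in I].
have repI I : I \in P -> rep I \in I by exact: mem_pick_block PP.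
pose Q i x := \prod_(b in M | b != i) (S i x - S b x).
have Q0 i x : i \in M -> B x -> Q i x != 0.
  move=> iM Bx; apply/prodf_neq0 => b /andP[bM bi].
  by rewrite -opprB oppr_eq0 S_neq // eq_sym.
have sQ i : smooth_on B (Q i).
  by apply: smooth_prod => // b _; exact: smoothB.
pose phi i x := G i x / Q i x.
have sphi i : i \in M -> smooth_on B (phi i).
  by move=> iM; apply: smooth_div => // x; exact: Q0.
have dphi i : i \in M -> depends_only_on [set i]%SET B (phi i).
  move=> iM; apply: partial0_dep => //; first exact: sphi.
  move=> k z; rewrite inE => ki Bz.
  rewrite (partial_div hJ k (sG i) (sQ i) (fun x => Q0 i x iM) Bz) pG //.
  have ik : i != k by rewrite eq_sym.
  rewrite (@partial_sep_prod _ _ _ (a i k z)) //.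
  - by rewrite -/(Q i z) [X in X / _](_ : _ = 0) ?mul0r //; ring.
  - move=> x u Bx Bu xu; apply: dS => // j; rewrite inE => /eqP ->; apply: xu.
    by rewrite !inE.
  - by move=> _; rewrite -(eqS ik Bz) -mulrN opprB.
  (* For [k] outside [M] the equation says a_ik (S_k - S_i) = 0, and the difference is nonzero
     because [i] is in [M]. *)
  - rewrite ki andbT => kM; have /eqP := eqS ik Bz; rewrite MN //.
    rewrite mulf_eq0 => /orP[/eqP//|].
    by rewrite -oppr_eq0 opprB (negbTE (S_neq _ _ _ iM ki Bz)).
pose W I x := \prod_(b in M) (S (rep I) x - S b x).
have sW I : smooth_on B (W I).
  by apply: smooth_prod => // b _; exact: smoothB.
have W0 I x : I \in P -> B x -> W I x != 0.
  move=> IP Bx; apply/prodf_neq0 => b bM.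
  rewrite -opprB oppr_eq0 S_neq //.
  by apply: contraNneq (PM _ _ IP (repI _ IP)) => ->.
pose F I i x := G i x / W I x.
have sF I i : I \in P -> smooth_on B (F I i).
  by move=> IP; apply: smooth_div => // x; exact: W0.
have dF I i : I \in P -> i \in I -> depends_only_on I B (F I i).
  move=> IP iI; have iM := PM _ _ IP iI; have rM := PM _ _ IP (repI _ IP).
  apply: partial0_dep => //; first exact: sF.
  move=> k z kI Bz; have ik : i != k by apply: contraNneq kI => <-.
  rewrite (partial_div hJ k (sG i) (sW I) (fun x => W0 I x IP) Bz) pG //.
  rewrite (@partial_sep_prod _ _ _ (a i k z)) //.
  - by rewrite -/(W I z) [X in X / _](_ : _ = 0) ?mul0r //; ring.
  - by move=> x u Bx Bu _; exact: S_cst.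
  - move=> _; rewrite -(eqS ik Bz) -mulrN opprB (S_cst _ z p rM) // (S_cst i z p) //.
    by have := PE _ _ _ IP iI rM; rewrite repI // => /esym/eqP ->.
  (* Here [k] lies in another block, so S_k and S_i are different constants and a_ik = 0. *)
  - move=> kM; have /eqP := eqS ik Bz; rewrite MN // mulf_eq0 => /orP[/eqP//|].
    rewrite (S_cst k z p) // (S_cst i z p) // subr_eq0 eq_sym => ki.
    by have := PE _ _ _ IP iI kM; rewrite (negbTE kI) /e0 ki.
exists M, P, (fun i => slice p i (phi i)), (fun i => slice p i (S i)).
exists (fun I => S (rep I) p), (diag_coef F); split.
- exact: PP.
- by left; apply/set0Pn; exists o.
- move=> i iM; have [x [Bx ix]] := MP _ iM.
  split; [exact/slice_smooth/sphi|exact: slice_smooth|].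
  exact: (slice_nonconstant hJ Bp (@dS i) Bx ix).
- by move=> I IP; apply: block_diag_coef => i iI; split; [exact: sF|exact: dF].
have SE i x : B x -> slice p i (S i) (x 0 i) = S i x by exact: (sliceE Bp (@dS i)).
move=> x Bx; rewrite gG //; apply: diag_mx_block => //.
- move=> i iM; rewrite mxE (sliceE Bp (dphi i iM) Bx) SE //.
  rewrite (eq_bigr (fun b => S i x - S b x)); last by move=> b _; rewrite SE.
  by rewrite divfK // Q0.
- move=> I i IP iI; rewrite mxE /diag_coef eqxx /F.
  rewrite (eq_bigr (fun b => S (rep I) x - S b x)).
    by rewrite mulrC divfK // W0.
  by move=> b _; rewrite SE // (S_cst (rep I) x p) //; exact: PM IP (repI _ IP).
- by move=> I i j _ _ /negbTE ij; rewrite /diag_coef ij.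
Qed.

End Separating.

(** * Construction of the separating functions *)

Section Construction.
Context (R : realType) (n : nat) (J : 'I_n -> set R).
Hypothesis hJ : open_intervals J.
Local Notation B := (box J).
Variables (g : 'rV[R]_n -> 'M[R]_n) (G : 'I_n -> 'rV[R]_n -> R).
Hypothesis sG : forall i, smooth_on B (G i).
Hypothesis G0 : forall i x, B x -> G i x != 0.
Hypothesis gG : forall x, B x -> g x = diag_mx (\row_i G i x).
Local Notation a := (logd G).
Hypothesis sysG : logd_system B a.

Let oB := box_open hJ.
Let sa i k : smooth_on B (a i k) := smooth_logd hJ sG G0 i k.
Let pG i k x : B x -> partial k (G i) x = a i k x * G i x :=
  @partial_logd _ _ _ _ G0 i k x.

Section Extension.
Variables (S : 'I_n -> 'rV[R]_n -> R) (o : 'I_n) (y : 'rV[R]_n).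
Hypothesis sS : forall c, smooth_on B (S c).
Hypothesis dS : forall c, depends_only_on [set c]%SET B (S c).
Hypothesis By : B y.
Hypothesis Soy : partial o (S o) y != 0.
Hypothesis eqo : forall c x, c != o -> B x ->
  a c o x * (S o x - S c x) = partial o (S o) x.

Let pS := partial_sep hJ dS.

(** S_o' depends on x_o only, so changing x_o alone reaches a point where it is nonzero. *)
Let move_o x : B x -> exists z, [/\ B z, partial o (S o) z != 0
  & forall i, i != o -> z 0 i = x 0 i].
Proof.
move=> Bx; exists (mix [set o]%SET y x).
have Bz : B (mix [set o]%SET y x) by exact: box_mix.
split=> // [|i io]; last by rewrite mixE inE (negbTE io).
rewrite (dep_partial hJ o (@dS o) Bz By) // => i.
by rewrite inE => /eqP->; rewrite mixE inE eqxx.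
Qed.

(** Let D be the difference of the two sides. Since d_o D = 0, a point with S_o' nonzero suffices.
    There the x_b-derivative of [eqo] for [b] gives a_bo D = 0, while [eqo] itself forces a_bo to be
    nonzero. *)
Lemma separating_root b x : b != o -> B x ->
  a o b x * (S b x - S o x) = partial b (S b) x.
Proof.
move=> bo Bx; have [_ e1 _ _] := sysG; have ob : o != b by rewrite eq_sym.
have sbo := smoothB oB (sS b) (sS o); have sob := smoothB oB (sS o) (sS b).
have spS := smooth_partial b (sS b).
pose D x := a o b x * (S b x - S o x) - partial b (S b) x.
have sD : smooth_on B D by apply: smoothB => //; exact: smoothM.
suff Dx : D x = 0 by apply/eqP; rewrite -subr_eq0 -/(D x) Dx.
have [z [Bz Sz zx]] := move_o Bx.
have <- : D z = D x.
  apply: (partial0_line hJ sD (k := o)) => // u Bu.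
  rewrite /D (partialB o (smoothM oB (sa o b) sbo) spS Bu).
  rewrite (partialM o (sa o b) sbo Bu) (partialB o (sS b) (sS o) Bu) pS //.
  rewrite (dep_partial0 hJ (dep_partial hJ b (@dS b))) ?inE // e1 // -(eqo bo Bu).
  by ring.
have /eqP : partial b (fun u => a b o u * (S o u - S b u)) z = 0.
  rewrite (@partial_ext _ _ _ hJ _ _ (partial o (S o)) _ Bz); last exact: (fun u => eqo bo).
  by apply: (dep_partial0 hJ (dep_partial hJ o (@dS o))); rewrite ?inE.
rewrite (partialM b (sa b o) sob Bz) (partialB b (sS o) (sS b) Bz) pS // e1 //.
rewrite (_ : _ + _ = a b o z * D z); last by rewrite /D; ring.
rewrite mulf_eq0 => /orP[/eqP ab0|/eqP//].
by move: Sz; rewrite -(eqo bo Bz) ab0 mul0r eqxx.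
Qed.

(** For [b] and [c] other than [o] both sides depend on x_b and x_c only, so x_o can be moved to
    where S_o' is nonzero. The quadratic relation for (c, o, b) then yields S_o' times the claim. *)
Lemma separating_extend b c x : c != b -> B x ->
  a c b x * (S b x - S c x) = partial b (S b) x.
Proof.
have [->|bo] := eqVneq b o; first exact: eqo.
have [->|co] := eqVneq c o; first by move=> _; exact: separating_root.
move=> cb Bx; have [z [Bz Sz zx]] := move_o Bx.
have Sx i : i != o -> S i z = S i x.
  by move=> io; apply: dS => // j; rewrite inE => /eqP->; exact: zx.
have <- : a c b z = a c b x.
  apply: (logd_dep hJ sG G0 sysG cb Bz Bx) => j; rewrite !inE.
  by move=> /orP[]/eqP->; exact: zx.
have <- : partial b (S b) z = partial b (S b) x.
  by apply: (dep_partial hJ b (@dS b) Bz Bx) => j; rewrite inE => /eqP->; exact: zx.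
rewrite -!Sx // -(separating_root bo Bz).
have [_ _ _ /(_ c o b z co cb)] := sysG; rewrite eq_sym => /(_ bo Bz) e3.
have ec := eqo co Bz; have eb := eqo bo Bz.
apply: (mulfI Sz); apply/eqP; rewrite -subr_eq0; apply/eqP.
move: e3 ec eb; set D := partial o (S o) z => e3 ec eb.
(* The three summands are multiples of the quadratic relation and of [eqo] for [b] and for [c]. *)
transitivity ((S o z - S c z) * (S o z - S b z)
    * (a c o z * a o b z + a c b z * a b o z - a c o z * a c b z)
  + a c b z * (S o z - S c z) * (D - a b o z * (S o z - S b z))
  + (a o b z - a c b z) * (S o z - S b z) * (D - a c o z * (S o z - S c z))).
  by ring.
by rewrite e3 ec eb !subrr !mulr0 !addr0.
Qed.

End Extension.

Section MutualPair.
Variables o q : 'I_n.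
Hypothesis oq : o != q.
Hypothesis oall : forall i, i != o -> affects J G o i.
Hypothesis qo : affects J G q o.

Let qo' : q != o. Proof. by rewrite eq_sym. Qed.

Lemma form1_mutual : form1 J g.
Proof.
have [_ e1 _ e3] := sysG; have [e0 _ _ _] := sysG.
have [p [Bp aoq aqo]] := affects_at hJ sG G0 sysG oq qo' qo' qo (oall qo').
(* F solves d_o F = a_qo F, d_q F = a_oq F on the (x_o, x_q)-plane through p;
   the compatibility d_o d_q F = 0 makes it a difference s1(x_o) - s2(x_q).
   The quadratic relation for (c, o, q) then dictates S c. *)
pose u x := mix [set o; q]%SET x p; pose w x := mix [set o]%SET x p.
have Bu x : B x -> B (u x) by move=> Bx; exact: box_mix.
have Bw x : B x -> B (w x) by move=> Bx; exact: box_mix.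
have uw x i : i != q -> u x 0 i = w x 0 i.
  by move=> iq; rewrite !mixE !inE (negbTE iq) orbF.
have ux x i : (i == o) || (i == q) -> u x 0 i = x 0 i.
  by move=> h; rewrite mixE !inE h.
have up : u p = p by apply/rowP => i; rewrite mixE if_same.
have wp : w p = p by apply/rowP => i; rewrite mixE if_same.
(* [s1] and [F] are normalised to 1 at [p], hence [s2] to 0. Quotients of values of [G] take the
   place of exponentials of integrals. *)
pose s1 x := G q (w x) / G q p; pose v x := G o (u x) / G o (w x).
pose F x := v x * s1 x; pose s2 x := s1 x - F x.
have ss1 : smooth_on B s1.
  apply: smooth_div => //; [by move=> _ _; exact: G0|exact: smooth_mix|exact: smooth_cst].
have Gw0 x : B x -> G o (w x) != 0 by move=> Bx; exact/G0/Bw.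
have sGu : smooth_on B (fun x => G o (u x)) by exact: smooth_mix.
have sGw : smooth_on B (fun x => G o (w x)) by exact: smooth_mix.
have sv : smooth_on B v by exact: smooth_div.
have sF : smooth_on B F by exact: smoothM.
have ss2 : smooth_on B s2 by exact: smoothB.
have s1p : s1 p = 1 by rewrite /s1 wp divff // G0.
have Fp : F p = 1 by rewrite /F s1p mulr1 /v up wp divff // G0.
have s2p : s2 p = 0 by rewrite /s2 s1p Fp subrr.
have ds1 k x : B x -> partial k s1 x = if k == o then a q o (w x) * s1 x else 0.
  move=> Bx; rewrite /s1 (partialM k (smooth_mix [set o]%SET Bp (sG q)) (smooth_cst _) Bx).
  rewrite partial_cst mulr0 addr0 (partial_mix [set o]%SET p (G q)) inE.
  by case: eqP => [->|_]; rewrite ?mul0r // pG ?mulrA //; exact: Bw.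
have dv k x : B x -> partial k v x = v x *
    (if k == o then a o o (u x) - a o o (w x) else if k == q then a o q (u x) else 0).
  move=> Bx; rewrite (partial_div hJ k sGu sGw Gw0 Bx).
  rewrite (partial_mix [set o; q]%SET p (G o)) (partial_mix [set o]%SET p (G o)) !inE.
  have [->|ko] := eqVneq k o; first by rewrite /= !pG -/(u x) -/(w x); [rewrite /v; field; exact: Gw0|exact: Bw|exact: Bu].
  have [->|kq] := eqVneq k q; first by rewrite /= mulr0 subr0 pG -/(u x); [rewrite /v; field; exact: Gw0|exact: Bu].
  by rewrite /= !mul0r mulr0 subr0 mul0r mulr0.
(* Both a_oo and a_qo have x_q-derivative - a_qo a_oq, so their difference agrees at [u x] and
   [w x], which differ only in x_q. *)
have aou x : B x -> a o o (u x) - a o o (w x) = a q o (u x) - a q o (w x).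
  move=> Bx; suff : a o o (u x) - a q o (u x) = a o o (w x) - a q o (w x) by move=> h; lra.
  apply: (@partial0_line _ _ _ hJ (fun x => a o o x - a q o x) q) => //.
  - exact: smoothB.
  - by move=> z Bz; rewrite (partialB q (sa o o) (sa q o) Bz) e0 // e1 // subrr.
  - exact: Bu.
  - exact: Bw.
  - exact: uw.
have aqu x : B x -> a q o (u x) = a q o x.
  move=> Bx; apply: (logd_dep hJ sG G0 sysG qo' (Bu _ Bx) Bx) => i.
  by rewrite !inE orbC; exact: ux.
have aoqu x : B x -> a o q (u x) = a o q x.
  move=> Bx; apply: (logd_dep hJ sG G0 sysG oq (Bu _ Bx) Bx) => i.
  by rewrite !inE; exact: ux.
have dF k x : B x -> partial k F x = F x *
    (if k == o then a q o x else if k == q then a o q x else 0).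
  move=> Bx; rewrite (partialM k sv ss1 Bx) ds1 // dv // /F aou // aqu // aoqu //.
  by case: (k == o); [ring|case: (k == q); ring].
(* a_qo G_o does not depend on x_q, so a_qo F can be evaluated with x_q frozen, which leaves a
   function of x_o. *)
have aF x : B x -> a q o x * F x = partial o s1 x.
  move=> Bx; rewrite ds1 // eqxx /F mulrA; congr (_ * _).
  have h := logdG_const hJ sG G0 sysG qo' (Bu _ Bx) (Bw _ Bx) (uw x).
  by rewrite -aqu // /v mulrA h mulfK // Gw0.
have ds2 k x : B x -> partial k s2 x = if k == q then - (a o q x * F x) else 0.
  move=> Bx; rewrite (partialB k ss1 sF Bx) dF //.
  have [->|ko] := eqVneq k o.
    by rewrite -aF // (negbTE oq) mulrC subrr.
  rewrite ds1 // (negbTE ko) sub0r; case: eqP => _; first by rewrite mulrC.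
  by rewrite mulr0 oppr0.
have dep1 : depends_only_on [set o]%SET B s1.
  by apply: partial0_dep => // k z; rewrite inE => ko Bz; rewrite ds1 // (negbTE ko).
have dep2 : depends_only_on [set q]%SET B s2.
  by apply: partial0_dep => // k z; rewrite inE => kq Bz; rewrite ds2 // (negbTE kq).
(* Choose x_o with a_co nonzero; a_oq is nonzero when x_q = p_q, so the quadratic relation for (c,
   o, q) excludes a_cq = 0 there. *)
have acq c x : c != o -> c != q -> B x -> x 0 q = p 0 q -> a c q x != 0.
  move=> co cq Bx xq; have [y [By ay]] := oall co.
  pose z := mix [set o]%SET y x; have Bz : B z by exact: box_mix.
  have zq : z 0 q = p 0 q by rewrite mixE inE (negbTE qo').
  have az : a c o z != 0.
    by apply: (logd_neq0 hJ sG G0 sysG co By Bz) ay; rewrite mixE inE eqxx.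
  have azoq : a o q z != 0 by apply: (logd_neq0 hJ sG G0 sysG oq Bp Bz) aoq.
  apply: (logd_neq0 hJ sG G0 sysG cq Bz Bx); first by rewrite zq.
  apply/eqP => cz; have /eqP := e3 c o q z co cq oq Bz.
  by rewrite cz mulr0 mul0r addr0 eq_sym mulf_eq0 (negbTE az) (negbTE azoq).
(* For the other [c] the value is forced by a_cq (S_q - S_c) = d_q S_q at x_q = p_q, where S_q = 0
   and d_q S_q = - a_oq(p). *)
pose S c x := if c == o then s1 x else if c == q then s2 x
  else a o q p / a c q (mix [set c]%SET x p).
have So : S o = s1 by apply/funext => x; rewrite /S eqxx.
have Sq : S q = s2 by apply/funext => x; rewrite /S (negbTE qo') eqxx.
have mq c x : c != q -> mix [set c]%SET x p 0 q = p 0 q.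
  by move=> cq; rewrite mixE inE eq_sym (negbTE cq).
have sS c : smooth_on B (S c).
  have [->|co] := eqVneq c o; first by rewrite So.
  have [->|cq] := eqVneq c q; first by rewrite Sq.
  rewrite (_ : S c = fun x => a o q p / a c q (mix [set c]%SET x p)); last first.
    by apply/funext => x; rewrite /S (negbTE co) (negbTE cq).
  apply: smooth_div => //; [|exact: smooth_cst|exact: smooth_mix].
  by move=> x Bx; apply: acq => //; [exact: box_mix|exact: mq].
have dS c : depends_only_on [set c]%SET B (S c).
  have [->|co] := eqVneq c o; first by rewrite So.
  have [->|cq] := eqVneq c q; first by rewrite Sq.
  move=> x y _ _ xy; rewrite /S (negbTE co) (negbTE cq); congr (_ / a c q _).
  by apply/rowP => i; rewrite !mixE; case: ifP => // /xy.
have Sop : partial o (S o) p != 0.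
  by rewrite So -aF // Fp mulr1.
apply: (form1_separating hJ sG G0 gG sS dS _ Bp Sop).
move=> b c x; apply: (separating_extend sS dS Bp Sop) => {b c x}c x co Bx.
rewrite So; have [->|cq] := eqVneq c q.
  by rewrite Sq -aF // /s2 opprB addrCA subrr addr0.
(* The equation to prove involves x_o and x_c only, so x_q may be moved to p_q, where [s2] vanishes
   and [F] equals [s1]. *)
pose z := mix [set q]%SET p x; have Bz : B z by exact: box_mix.
have zo i : i != q -> z 0 i = x 0 i by move=> iq; rewrite mixE inE (negbTE iq).
have zq : z 0 q = p 0 q by rewrite mixE inE eqxx.
have s1z : s1 z = s1 x by apply: dep1 => // i; rewrite inE => /eqP->; exact: zo.
have s2z : s2 z = 0.
  by rewrite -s2p; apply: dep2 => // i; rewrite inE => /eqP->.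
have Fz : F z = s1 x.
  by rewrite -s1z; apply/eqP; rewrite eq_sym -subr_eq0 -/(s2 z) s2z.
have ez : a o q z * s1 x = a o q p.
  have : partial q s2 z = partial q s2 p.
    by apply: (dep_partial hJ q dep2) => // i; rewrite inE => /eqP->.
  by rewrite !ds2 // eqxx Fp mulr1 Fz => /oppr_inj.
have dz : a q o z * s1 x = partial o s1 x.
  rewrite -{1}Fz aF //; apply: (dep_partial hJ o dep1) => // i.
  by rewrite inE => /eqP->; exact: zo.
have acoz : a c o z = a c o x.
  apply: (logd_dep hJ sG G0 sysG co Bz Bx) => i; rewrite !inE.
  by move=> /orP[]/eqP->; exact: zo.
have acqz : a c q z = a c q (mix [set c]%SET x p).
  apply: (logd_dep hJ sG G0 sysG cq) => //; first exact: box_mix.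
  move=> i; rewrite !inE => /orP[]/eqP->; last by rewrite zq mq.
  by rewrite zo // mixE inE eqxx.
have A0 : a c q z != 0 by exact: acq.
have := e3 c o q z co cq oq Bz; rewrite acoz /S (negbTE co) (negbTE cq) -acqz -ez -dz => e.
(* After multiplication by a_cq, the quadratic relation replaces a_co a_cq - a_co a_oq by a_cq
   a_qo. *)
apply: (mulfI A0); transitivity ((a c o x * a c q z - a c o x * a o q z) * s1 x).
  by field.
by rewrite e; ring.
Qed.

End MutualPair.

End Construction.

(** * From the metric to the two forms *)

Lemma separable_logd_system (R : realType) (n : nat) (J : 'I_n -> set R)
    (g : 'rV[R]_n -> 'M[R]_n) (G : 'I_n -> 'rV[R]_n -> R) :
  open_intervals J ->
  (forall i, smooth_on (box J) (G i)) ->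
  (forall i x, box J x -> G i x != 0) ->
  (forall x, box J x -> g x = diag_mx (\row_i G i x)) ->
  separable_coordinates (box J) g -> diagonal_curvature (box J) g ->
  logd_system (box J) (logd G).
Proof.
move=> hJ sG G0 gG hsep hcurv.
have lc i k l x := @levi_civita _ _ _ _ _ sG G0 gG hsep i k l x.
have rm i j k x : i != j -> i != k -> j != k -> box J x ->
    2 * partial k (logd G i j) x + logd G i k x * logd G i j x
    - logd G i j x * logd G j k x - logd G i k x * logd G k j x = 0.
  move=> ij ik jk Bx; have := riemann_metric hJ sG G0 gG ij ik jk Bx.
  rewrite (hcurv x Bx i j k jk) mulr0 => /esym/eqP.
  by rewrite mulf_eq0 oppr_eq0 (negbTE (G0 i x Bx)) => /eqP.
split.
- by move=> k l x lk Bx; have := lc k k l x lk Bx; move=> h; lra.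
- by move=> i k x ik Bx; have := lc i k i x ik Bx; move=> h; lra.
(* Write D for d_k a_ij and X for a_ij a_ik - a_ij a_jk - a_ik a_kj. Curvature gives 2 D + X = 0 and
   Levi-Civita gives D - X = 0, so D = X = 0. *)
- move=> i j k x ij ik jk Bx.
  have h1 := rm i j k x ij ik jk Bx; have kj : k != j by rewrite eq_sym.
  by have h2 := lc i j k x kj Bx; lra.
- move=> i j k x ij ik jk Bx.
  have h1 := rm i j k x ij ik jk Bx; have kj : k != j by rewrite eq_sym.
  by have h2 := lc i j k x kj Bx; lra.
Qed.

Theorem mainTheorem1 (R : realType) (n : nat) (hn : (1 <= n)%N)
    (J : 'I_n -> set R) (hJ : open_intervals J)
    (g : 'rV[R]_n -> 'M[R]_n)
    (hg : pseudo_riemannian (box J) g)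
    (hortho : orthogonal_coordinates (box J) g)
    (hsep : separable_coordinates (box J) g)
    (hcurv : diagonal_curvature (box J) g) :
  form1 J g \/ form2 J g.
Proof.
pose G (i : 'I_n) x := g x i i.
have [e [H [e1 _ H0 gH]]] := hortho.
have sG i : smooth_on (box J) (G i) by have [sg _ _] := hg; exact: sg.
have G0 i x : box J x -> G i x != 0.
  move=> Bx; rewrite /G gH // !mxE eqxx mulr1n mulf_neq0 //.
    by have [->|->] := e1 i; rewrite ?oppr_eq0 oner_eq0.
  by rewrite expf_neq0 // gt_eqF // H0.
have gG x : box J x -> g x = diag_mx (\row_i G i x).
  move=> Bx; apply/matrixP => i j; rewrite /G gH // !mxE eqxx.
  by case: eqP.
have sysG := separable_logd_system hJ sG G0 gG hsep hcurv.
have [r rr] := exists_root hJ sG G0 sysG (Ordinal hn).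
have [/forallP rall|] := boolP [forall k, affects_eq J G r k]; last first.
  move=> /forallPn[m rm]; left.
  apply: (@form1_product _ _ _ hJ _ _ sG G0 gG [set k | affects_eq J G r k]%SET r m).
  - by rewrite inE affects_eq_refl.
  - by rewrite inE.
  - move=> k l; rewrite !inE; exact: root_closed rr.
have rall' i : i != r -> affects J G r i.
  by move=> ir; apply: affects_eqP (rall i) _; rewrite eq_sym.
have [[q [qr qar]]|nq] := pselect (exists q, q != r /\ affects J G q r).
  left; apply: (form1_mutual hJ sG G0 gG sysG _ rall' qar).
  by rewrite eq_sym.
right; apply: (form2_warped hJ sG G0 gG sysG rall') => i ir ar.
by apply: nq; exists i.
Qed.
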